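(* The following five identities of formal power series in $q$ hold: \begin{align*} \sum_{n_1=0}^\infty\sum_{n_2=0}^{2n_1} \frac{q^{n_1^2+n_2^2-n_1n_2+n_1+n_2}}{(q;q)_{n_1}}\begin{bmatrix}2n_1\\ n_2\end{bmatrix}_q &=\frac{1}{(q^2,q^3,q^3,q^4,q^4,q^5;q^7)_\infty},\\ \sum_{n_1=0}^\infty\sum_{n_2=0}^{2n_1} \frac{q^{n_1^2+n_2^2-n_1n_2+n_2}}{(q;q)_{n_1}}\begin{bmatrix}2n_1\\ n_2\end{bmatrix}_q &=\frac{1}{(q,q^2,q^3,q^4,q^5,q^6;q^7)_\infty},\\ \sum_{n_1=0}^\infty\sum_{n_2=0}^{2n_1+1} \frac{q^{n_1^2+n_2^2-n_1n_2+n_1}}{(q;q)_{n_1}}\begin{bmatrix}2n_1+1\\ n_2\end{bmatrix}_q &=\frac{1}{(q,q^2,q^3,q^4,q^5,q^6;q^7)_\infty},\\ \sum_{n_1=0}^\infty\sum_{n_2=0}^{2n_1+1} \frac{q^{n_1^2+n_2^2-n_1n_2+n_2}}{(q;q)_{n_1}}\begin{bmatrix}2n_1+1\\ n_2\end{bmatrix}_q &=\frac{1}{(q,q^2,q^2,q^5,q^5,q^6;q^7)_\infty},\\ \sum_{n_1=0}^\infty\sum_{n_2=0}^{2n_1} \frac{q^{n_1^2+n_2^2-n_1n_2}}{(q;q)_{n_1}}\begin{bmatrix}2n_1\\ n_2\end{bmatrix}_q &=\frac{1}{(q,q,q^3,q^4,q^6,q^6;q^7)_\infty}. \end{align*}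
   Context: For a formal variable $a$, $(a;q)_\infty=\prod_{i\ge 0}(1-aq^i)$ and $(a;q)_n=(a;q)_\infty/(aq^n;q)_\infty=\prod_{i=0}^{n-1}(1-aq^i)$. Also $(a_1,\ldots,a_k;q)_\infty=\prod_{i=1}^k(a_i;q)_\infty$ (repeated arguments contribute repeated factors). The Gaussian polynomial is $\begin{bmatrix}n\\ k\end{bmatrix}_q=\frac{(q;q)_n}{(q;q)_k(q;q)_{n-k}}$ for $0\le k\le n$. *)

(* Defs.v *)
From HB Require Import structures.
From mathcomp Require Import all_boot all_order all_algebra.
From mathcomp Require Import boolp classical_sets.

Set Implicit Arguments.
Unset Strict Implicit.
Unset Printing Implicit Defensive.

Import GRing.Theory.
Local Open Scope ring_scope.

(* A wrapper around coefficient sequences, so that the Cauchy product does not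
   compete with the pointwise structures on [nat -> R]. *)
Record fps (R : Type) := Fps { fcoef : nat -> R }.

Lemma fpsP (R : Type) (f g : fps R) :
  (forall n, fcoef f n = fcoef g n) -> f = g.
Proof. by case: f g => [f] [g] /= /funext ->. Qed.

HB.instance Definition _ (R : Type) := gen_eqMixin (fps R).
HB.instance Definition _ (R : Type) := gen_choiceMixin (fps R).

Section FpsZmodule.
Variable R : zmodType.
Implicit Types f g : fps R.

Definition fps_zero : fps R := Fps (fun=> 0).
Definition fps_opp f : fps R := Fps (fun n => - fcoef f n).
Definition fps_add f g : fps R := Fps (fun n => fcoef f n + fcoef g n).

Fact fps_addA : associative fps_add.
Proof. by move=> f g h; apply: fpsP => n /=; rewrite addrA. Qed.
Fact fps_addC : commutative fps_add.
Proof. by move=> f g; apply: fpsP => n /=; rewrite addrC. Qed.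
Fact fps_add0 : left_id fps_zero fps_add.
Proof. by move=> f; apply: fpsP => n /=; rewrite add0r. Qed.
Fact fps_addN : left_inverse fps_zero fps_opp fps_add.
Proof. by move=> f; apply: fpsP => n /=; rewrite addNr. Qed.

HB.instance Definition _ :=
  GRing.isZmodule.Build (fps R) fps_addA fps_addC fps_add0 fps_addN.

End FpsZmodule.

Section FpsRing.
Variable R : comNzRingType.
Implicit Types f g : fps R.

Definition fps_one : fps R := Fps (fun n => (n == 0)%N%:R).
Definition fps_mul f g : fps R :=
  Fps (fun n => \sum_(i < n.+1) fcoef f i * fcoef g (n - i)).

Definition fps_trunc N f : {poly R} := \poly_(i < N) fcoef f i.

Lemma fps_mul_trunc N f g n : (n < N)%N ->
  fcoef (fps_mul f g) n = (fps_trunc N f * fps_trunc N g)`_n.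
Proof.
move=> ltnN; rewrite coefM; apply: eq_bigr => i _.
rewrite !coef_poly (leq_ltn_trans (ltn_ord i : (i <= n)%N) ltnN).
by rewrite (leq_ltn_trans (leq_subr _ _) ltnN).
Qed.

Fact fps_mulA : associative fps_mul.
Proof.
move=> f g h; apply: fpsP => n; rewrite !(@fps_mul_trunc n.+1) //.
have truncM u v i : (i < n.+1)%N ->
    (fps_trunc n.+1 (fps_mul u v))`_i = (fps_trunc n.+1 u * fps_trunc n.+1 v)`_i.
  by move=> lti; rewrite coef_poly lti (fps_mul_trunc _ _ lti).
transitivity ((fps_trunc n.+1 f * (fps_trunc n.+1 g * fps_trunc n.+1 h))`_n).
  rewrite !coefM; apply: eq_bigr => i _.
  by rewrite truncM // ltnS leq_subr.
by rewrite mulrA 2!coefM; apply: eq_bigr => i _; rewrite truncM.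
Qed.
Fact fps_mulC : commutative fps_mul.
Proof. by move=> f g; apply: fpsP => n; rewrite !(@fps_mul_trunc n.+1) // mulrC. Qed.
Fact fps_mul1 : left_id fps_one fps_mul.
Proof.
move=> f; apply: fpsP => n /=.
by rewrite big_ord_recl /= mul1r subn0 big1 ?addr0 // => i _; rewrite mul0r.
Qed.
Fact fps_mulDl : left_distributive fps_mul +%R.
Proof.
move=> f g h; apply: fpsP => n /=.
by rewrite -big_split; apply: eq_bigr => i _ /=; rewrite mulrDl.
Qed.
Fact fps_one_neq0 : fps_one != 0.
Proof.
by apply/eqP => /(congr1 (fun f => fcoef f 0)) /= /eqP; rewrite oner_eq0.
Qed.

HB.instance Definition _ := GRing.Zmodule_isComNzRing.Build (fps R)
  fps_mulA fps_mulC fps_mul1 fps_mulDl fps_one_neq0.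

Lemma fcoefM f g n :
  fcoef (f * g) n = \sum_(i < n.+1) fcoef f i * fcoef g (n - i).
Proof. by []. Qed.
Lemma fcoef1 n : fcoef (1 : fps R) n = (n == 0)%N%:R.
Proof. by []. Qed.
Lemma fcoefB f g n : fcoef (f - g) n = fcoef f n - fcoef g n.
Proof. by []. Qed.

Definition fpsX : fps R := Fps (fun n => (n == 1)%N%:R).

End FpsRing.

Arguments fpsX {R}.

Section FpsUnitRing.
Variable R : comUnitRingType.
Implicit Types f g : fps R.

(* The first N coefficients of the inverse, from
   b_n = (f 0)^-1 * ([n = 0] - \sum_(j < n) f (n - j) * b_j). *)
Fixpoint fps_inv_seq f N : seq R :=
  if N is n.+1 then
    let s := fps_inv_seq f n in
    rcons s ((fcoef f 0)^-1 *
             ((n == 0)%N%:R - \sum_(j < n) fcoef f (n - j) * s`_j))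
  else [::].

Definition fps_unit : {pred fps R} := fun f => fcoef f 0 \is a GRing.unit.
Definition fps_inv f : fps R :=
  if fps_unit f then Fps (fun n => (fps_inv_seq f n.+1)`_n) else f.

Lemma size_fps_inv_seq f N : size (fps_inv_seq f N) = N.
Proof. by elim: N => //= N IHN; rewrite size_rcons IHN. Qed.

Lemma nth_fps_inv_seq f N n : (n < N)%N ->
  (fps_inv_seq f N)`_n = (fps_inv_seq f n.+1)`_n.
Proof.
elim: N => // N IHN; rewrite ltnS leq_eqVlt => /predU1P[-> //|ltnN].
by rewrite -IHN //= nth_rcons size_fps_inv_seq ltnN.
Qed.

Lemma fps_inv_seqE f n : (fps_inv_seq f n.+1)`_n =
  (fcoef f 0)^-1 *
    ((n == 0)%N%:R - \sum_(j < n) fcoef f (n - j) * (fps_inv_seq f j.+1)`_j).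
Proof.
rewrite [fps_inv_seq f n.+1]/= nth_rcons size_fps_inv_seq ltnn eqxx.
congr (_ * (_ - _)); apply: eq_bigr => j _.
by rewrite (nth_fps_inv_seq f (ltn_ord j)).
Qed.

Fact fps_mulV : {in fps_unit, left_inverse 1 fps_inv *%R}.
Proof.
move=> f fU; apply: fpsP => n; rewrite /fps_inv ifT // fcoefM fcoef1.
rewrite big_ord_recr [LHS]addrC subnn [fcoef (Fps _) _]fps_inv_seqE.
rewrite [X in X + _]mulrC mulVKr //.
rewrite [X in _ - _ + X](_ : _ =
  \sum_(j < n) fcoef f (n - j) * (fps_inv_seq f j.+1)`_j) ?subrK //.
by apply: eq_bigr => j _; rewrite mulrC.
Qed.
Fact fps_unitPl f g : g * f = 1 -> fps_unit f.
Proof.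
move=> /(congr1 (fun h => fcoef h 0)); rewrite fcoefM big_ord1 subnn => gf1.
by apply/unitrPr; exists (fcoef g 0); rewrite mulrC.
Qed.
Fact fps_inv_out : {in [predC fps_unit], fps_inv =1 id}.
Proof. by move=> f fNU; rewrite /fps_inv ifN. Qed.

HB.instance Definition _ := GRing.ComNzRing_hasMulInverse.Build (fps R)
  fps_mulV fps_unitPl fps_inv_out.

End FpsUnitRing.

(* X-adic convergence: each coefficient is eventually constant. *)
Definition fps_cvg (R : Type) (u : nat -> fps R) (l : fps R) : Prop :=
  forall n, exists N, forall m, (N <= m)%N -> fcoef (u m) n = fcoef l n.

(* The junk value for a divergent sequence is 0. *)
Definition fps_lim (R : zmodType) (u : nat -> fps R) : fps R :=
  xget 0 [set l | fps_cvg u l]%classic.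

Definition fps_has_sum (R : zmodType) (u : nat -> fps R) (l : fps R) : Prop :=
  fps_cvg (fun N => \sum_(0 <= n < N) u n) l.

Section QPochhammer.
Variable R : comUnitRingType.
Implicit Types a q : fps R.

Definition qpoch a q (n : nat) : fps R := \prod_(0 <= i < n) (1 - a * q ^+ i).

Definition qpoch_inf a q : fps R := fps_lim (qpoch a q).

Definition qpochs_inf (s : seq (fps R)) q : fps R :=
  \prod_(a <- s) qpoch_inf a q.

Definition gauss_binom q (n k : nat) : fps R :=
  if (k <= n)%N then qpoch q q n / (qpoch q q k * qpoch q q (n - k)) else 0.

End QPochhammer.

Lemma fps_cvg_unique (R : Type) (u : nat -> fps R) (l1 l2 : fps R) :
  fps_cvg u l1 -> fps_cvg u l2 -> l1 = l2.
Proof.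
move=> cu1 cu2; apply: fpsP => n; have [N1 h1] := cu1 n; have [N2 h2] := cu2 n.
by rewrite -(h1 (maxn N1 N2)) ?leq_maxl // h2 ?leq_maxr.
Qed.

Lemma fps_limE (R : zmodType) (u : nat -> fps R) (l : fps R) :
  fps_cvg u l -> fps_lim u = l.
Proof.
move=> cul; rewrite /fps_lim; case: xgetP => [l' _ /= cul'|/(_ l) //].
exact: fps_cvg_unique cul' cul.
Qed.

(* The junk value of fps_lim is never used by qpoch_inf when q has no constant
   term. *)
Lemma qpoch_inf_cvg (R : comUnitRingType) (a q : fps R) :
  fcoef q 0 = 0 -> fps_cvg (qpoch a q) (qpoch_inf a q).
Proof.
move=> q0.
have mul_low (f g : fps R) i n : (forall k, (k < i)%N -> fcoef g k = 0) ->
    (n < i)%N -> fcoef (f * g) n = 0.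
  move=> g0 ltni; rewrite fcoefM; apply: big1 => j _.
  by rewrite g0 ?mulr0 // (leq_ltn_trans (leq_subr _ _) ltni).
have expq_low i n : (n < i)%N -> fcoef (q ^+ i) n = 0.
  elim: i n => // i IHi n ltni; rewrite exprS fcoefM big_ord_recl q0 mul0r add0r.
  apply: big1 => j _; rewrite IHi ?mulr0 // lift0.
  by rewrite (leq_trans _ (ltni : (n <= i)%N)) // ltn_subrL (leq_trans _ (ltn_ord j)).
have stable n k : fcoef (qpoch a q (n.+1 + k)) n = fcoef (qpoch a q n.+1) n.
  elim: k => [|k IHk]; first by rewrite addn0.
  have -> : qpoch a q (n.+1 + k.+1) =
      qpoch a q (n.+1 + k) * (1 - a * q ^+ (n.+1 + k)).
    by rewrite addnS /qpoch big_nat_recr.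
  rewrite mulrBr mulr1 mulrA fcoefB IHk.
  by rewrite (mul_low _ _ _ _ (@expq_low (n.+1 + k)%N)) ?subr0 // leq_addr.
have cvgP : fps_cvg (qpoch a q) (Fps (fun n => fcoef (qpoch a q n.+1) n)).
  by move=> n; exists n.+1 => m ltnm; rewrite -(subnKC ltnm) stable.
by rewrite /qpoch_inf (fps_limE cvgP).
Qed.

(* Main.v *)
Require Import Defs.
From mathcomp Require Import all_boot all_order all_algebra.
From mathcomp Require Import zify ring.

(** Attach to the five cyclic classes of profiles of cylindric partitions of
    rank 3 and level 4 (400, 310, 301, 220, 211) series G_c(z), which are double
    sums weighted by z^(n1).  Pascal-type relations for the double sums show that
    H_c = G_c(z) / (z;q)_oo solves the Corteel-Welsh functional equations; on the
    coefficients H_{c,n} of z^n these read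
      H_{c,n-1} = sum_J (-1)^|J| q^(n|J|) H_{c(J),n},
    which determines H_{c,n} from H_{c,0} = 1.  The same recurrence is solved by
    the affine Weyl group sum
      sum_x sgn(x) q^(E_c(x)) / prod_j (q;q)_{n + x_j - j}
    (the terms of the recurrence that leave the alcove cancel by antisymmetry
    under the reflection in the corresponding wall), so the two agree for all n.
    For n -> oo this expresses G_c(1) as (q;q)_oo^(-2) times a theta series of
    the A_2 lattice, and the latter is a product by Macdonald's identity: expand
    three theta functions by the Jacobi triple product and sum over one of the
    three indices by Euler's pentagonal number theorem. *)

Set Implicit Arguments.
Unset Strict Implicit.
Unset Printing Implicit Defensive.

Import Order.POrderTheory GRing.Theory Num.Theory.
Local Open Scope ring_scope.

(** * Congruence of power series modulo powers of the variable, and limits *)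

Section Congruence.
Variable R : comUnitRingType.
Implicit Types f g h : fps R.

Definition eqm m f g := forall k, (k < m)%N -> fcoef f k = fcoef g k.

Lemma eqm_sym m f g : eqm m f g -> eqm m g f.
Proof. by move=> h k lt_km; rewrite h. Qed.

Lemma eqm_trans m g f h : eqm m f g -> eqm m g h -> eqm m f h.
Proof. by move=> h1 h2 k lt_km; rewrite h1 // h2. Qed.

Lemma eqmW m m' f g : (m <= m')%N -> eqm m' f g -> eqm m f g.
Proof. by move=> le_mm h k lt_km; apply: h; apply: leq_trans le_mm. Qed.

Lemma eqm_eq f g : (forall m, eqm m f g) -> f = g.
Proof. by move=> h; apply: fpsP => n; apply: (h n.+1). Qed.

Lemma eqmD m f f' g g' : eqm m f f' -> eqm m g g' -> eqm m (f + g) (f' + g').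
Proof. by move=> h1 h2 k lt_km /=; rewrite h1 // h2. Qed.

Lemma eqmN m f f' : eqm m f f' -> eqm m (- f) (- f').
Proof. by move=> h1 k lt_km /=; rewrite h1. Qed.

Lemma eqmM m f f' g g' : eqm m f f' -> eqm m g g' -> eqm m (f * g) (f' * g').
Proof.
move=> h1 h2 k lt_km; rewrite !fcoefM; apply: eq_bigr => i _.
by rewrite h1 ?h2 // (leq_ltn_trans _ lt_km) // ?leq_subr // -ltnS ltn_ord.
Qed.

Lemma eqm_sum m (T : Type) (s : seq T) (P : pred T) (F G : T -> fps R) :
  (forall x, P x -> eqm m (F x) (G x)) ->
  eqm m (\sum_(x <- s | P x) F x) (\sum_(x <- s | P x) G x).
Proof. by move=> h; apply: (big_ind2 (eqm m)) => // *; apply: eqmD. Qed.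

Lemma eqm_sum0 m (T : Type) (s : seq T) (P : pred T) (F : T -> fps R) :
  (forall x, P x -> eqm m (F x) 0) -> eqm m (\sum_(x <- s | P x) F x) 0.
Proof.
move=> h; have := eqm_sum s h; rewrite [X in eqm m _ X]big1 //.
Qed.

Lemma eqmM0l m f g : eqm m f 0 -> eqm m (f * g) 0.
Proof. by move=> h; rewrite -(mul0r g); apply: eqmM. Qed.

Lemma eqmM0r m f g : eqm m g 0 -> eqm m (f * g) 0.
Proof. by move=> h; rewrite -(mulr0 f); apply: eqmM. Qed.

Lemma eqmV m f g : f \is a GRing.unit -> g \is a GRing.unit ->
  eqm m f g -> eqm m f^-1 g^-1.
Proof.
move=> fU gU h; have -> : f^-1 = f^-1 * g * g^-1 by rewrite mulrK.
rewrite -[X in eqm m _ X]mul1r -{1}(mulVr fU).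
by apply: eqmM => //; apply: eqmM => //; apply: eqm_sym.
Qed.

Lemma fcoefXM f k : fcoef (fpsX * f) k = if k is k'.+1 then fcoef f k' else 0.
Proof.
rewrite fcoefM big_ord_recl /= mul0r add0r.
case: k => [|k]; first by rewrite big_ord0.
rewrite big_ord_recl /= mul1r subn1 big1 ?addr0 // => i _.
by rewrite /= mul0r.
Qed.

Lemma fcoefXnM f n k :
  fcoef (fpsX ^+ n * f) k = if (k < n)%N then 0 else fcoef f (k - n).
Proof.
elim: n k => [|n IHn] k; first by rewrite expr0 mul1r ltn0 subn0.
by rewrite exprS -mulrA fcoefXM; case: k => [|k] //; rewrite IHn ltnS.
Qed.

Lemma eqm_X m n f : (m <= n)%N -> eqm m (fpsX ^+ n * f) 0.
Proof. by move=> le_mn k lt_km; rewrite fcoefXnM (leq_trans lt_km). Qed.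

Lemma eqmX m n f g : eqm m f g -> eqm (n + m) (fpsX ^+ n * f) (fpsX ^+ n * g).
Proof.
move=> h k lt_k; rewrite !fcoefXnM; case: ltnP => // le_nk.
by apply: h; rewrite ltn_subLR.
Qed.

(** The variable is not a unit, so its powers are cancelled by injectivity instead of division. *)
Lemma fpsXn_inj n : injective (fun f => fpsX ^+ n * f).
Proof.
move=> f g /(congr1 (@fcoef R)) h; apply: fpsP => k.
by have := congr1 (fun u => u (n + k)%N) h; rewrite !fcoefXnM ltnNge leq_addr /= addKn.
Qed.

Lemma fps_cvgP (u : nat -> fps R) f :
  fps_cvg u f <-> forall m, exists N, forall n, (N <= n)%N -> eqm m (u n) f.
Proof.
split=> [cu m | h n]; last first.
  by have [N hN] := h n.+1; exists N => k le_Nk; apply: hN.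
elim: m => [|m [N hN]]; first by exists 0%N => n _ k.
have [N' hN'] := cu m; exists (maxn N N') => n; rewrite geq_max => /andP[h1 h2] k.
by rewrite ltnS leq_eqVlt => /predU1P[->|]; [apply: hN' | apply: hN].
Qed.

Lemma fps_cvg_const f : fps_cvg (fun=> f) f.
Proof. by move=> n; exists 0%N. Qed.

Lemma fps_cvgD u v f g :
  fps_cvg u f -> fps_cvg v g -> fps_cvg (fun n => u n + v n) (f + g).
Proof.
move=> /fps_cvgP cu /fps_cvgP cv; apply/fps_cvgP => m.
have [N h] := cu m; have [N' h'] := cv m; exists (maxn N N') => n.
by rewrite geq_max => /andP[h1 h2]; apply: eqmD; [apply: h | apply: h'].
Qed.

Lemma fps_cvgM u v f g :
  fps_cvg u f -> fps_cvg v g -> fps_cvg (fun n => u n * v n) (f * g).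
Proof.
move=> /fps_cvgP cu /fps_cvgP cv; apply/fps_cvgP => m.
have [N h] := cu m; have [N' h'] := cv m; exists (maxn N N') => n.
by rewrite geq_max => /andP[h1 h2]; apply: eqmM; [apply: h | apply: h'].
Qed.

Lemma fps_cvgV u f : (forall n, u n \is a GRing.unit) -> f \is a GRing.unit ->
  fps_cvg u f -> fps_cvg (fun n => (u n)^-1) f^-1.
Proof.
move=> uU fU /fps_cvgP cu; apply/fps_cvgP => m.
by have [N h] := cu m; exists N => n le_Nn; apply: eqmV => //; apply: h.
Qed.

Lemma fps_cvg_sub (u : nat -> fps R) (s : nat -> nat) f :
  (forall n, (n <= s n)%N) -> fps_cvg u f -> fps_cvg (u \o s) f.
Proof.
move=> hs cu n; have [N h] := cu n; exists N => m le_Nm.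
by apply: h; apply: leq_trans (hs m).
Qed.

Lemma fps_unitE f : (f \is a GRing.unit) = (fcoef f 0 \is a GRing.unit).
Proof. by []. Qed.

End Congruence.

(** * Unordered summation of formal power series *)

Section HasSum.
Variable R : comUnitRingType.

(** Modulo each power of the variable only the finitely many indices in [s] contribute. No order on
    the indices is involved, so reindexing, products and iterated sums are available. *)
Definition hsum (T : eqType) (F : T -> fps R) (f : fps R) := forall m,
  exists s : seq T, [/\ uniq s, forall x, x \notin s -> eqm m (F x) 0
    & eqm m (\sum_(x <- s) F x) f].

Lemma eqm_sum_subset (T : eqType) (F : T -> fps R) m (s s' : seq T) :
  uniq s -> uniq s' -> {subset s <= s'} ->
  (forall x, x \notin s -> eqm m (F x) 0) ->
  eqm m (\sum_(x <- s') F x) (\sum_(x <- s) F x).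
Proof.
move=> us us' sub0 h; rewrite (bigID (mem s)) /= -big_filter.
have p_s : perm_eq [seq x <- s' | x \in s] s.
  apply: uniq_perm => //; first exact: filter_uniq.
  by move=> x; rewrite mem_filter; case: (boolP (x \in s)) => // /sub0.
rewrite (perm_big _ p_s) /= -[X in eqm m _ X]addr0; apply: eqmD => //.
exact: eqm_sum0.
Qed.

Lemma eqm_sum_support (T : eqType) (F : T -> fps R) m (s t : seq T) :
  uniq s -> uniq t ->
  (forall x, x \notin s -> eqm m (F x) 0) ->
  (forall x, x \notin t -> eqm m (F x) 0) ->
  eqm m (\sum_(x <- s) F x) (\sum_(x <- t) F x).
Proof.
move=> us ut s0 t0; have ur := undup_uniq (s ++ t).
apply: eqm_trans (eqm_sym (eqm_sum_subset us ur _ s0)) (eqm_sum_subset ut ur _ t0);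
  by move=> x; rewrite mem_undup mem_cat => ->; rewrite ?orbT.
Qed.

Lemma hsum_unique (T : eqType) (F : T -> fps R) f g :
  hsum F f -> hsum F g -> f = g.
Proof.
move=> hf hg; apply: eqm_eq => m.
have [s [us s0 hs]] := hf m; have [t [ut t0 ht]] := hg m.
apply: eqm_trans (eqm_sym hs) _; apply: eqm_trans _ ht.
exact: eqm_sum_support.
Qed.

Lemma eq_hsum (T : eqType) (F G : T -> fps R) f : F =1 G -> hsum F f -> hsum G f.
Proof.
move=> e hF m; have [s [us h0 hs]] := hF m; exists s; split=> //.
  by move=> x /h0; rewrite e.
by rewrite -(eq_bigr _ (fun x _ => e x)).
Qed.

Lemma hsum_finite (T : eqType) (F : T -> fps R) s : uniq s ->
  (forall x, x \notin s -> F x = 0) -> hsum F (\sum_(x <- s) F x).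
Proof. by move=> us h m; exists s; split=> // x /h ->. Qed.

Lemma hsumD (T : eqType) (F G : T -> fps R) f g :
  hsum F f -> hsum G g -> hsum (fun x => F x + G x) (f + g).
Proof.
move=> hf hg m; have [s [us s0 hs]] := hf m; have [t [ut t0 ht]] := hg m.
set r := undup (s ++ t); have ur : uniq r by apply: undup_uniq.
have sr : {subset s <= r} by move=> x; rewrite mem_undup mem_cat => ->.
have tr : {subset t <= r} by move=> x; rewrite mem_undup mem_cat => ->; rewrite orbT.
exists r; split=> // [x | ].
  rewrite mem_undup mem_cat negb_or => /andP[/s0 h1 /t0 h2].
  by rewrite -[0]addr0; apply: eqmD.
rewrite big_split; apply: eqmD.
  exact: eqm_trans (eqm_sum_subset us ur sr s0) hs.
exact: eqm_trans (eqm_sum_subset ut ur tr t0) ht.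
Qed.

Lemma hsumMl (T : eqType) (F : T -> fps R) c f :
  hsum F f -> hsum (fun x => c * F x) (c * f).
Proof.
move=> hf m; have [s [us s0 hs]] := hf m; exists s; split=> // [x /s0|].
  exact: eqmM0r.
by rewrite -mulr_sumr; apply: eqmM.
Qed.

Lemma hsumMr (T : eqType) (F : T -> fps R) c f :
  hsum F f -> hsum (fun x => F x * c) (f * c).
Proof.
move/(hsumMl c); rewrite mulrC; apply: eq_hsum => x.
exact: mulrC.
Qed.

Lemma hsumN (T : eqType) (F : T -> fps R) f :
  hsum F f -> hsum (fun x => - F x) (- f).
Proof.
move/(hsumMl (-1)); rewrite mulN1r; apply: eq_hsum => x.
by rewrite mulN1r.
Qed.

Lemma hsumB (T : eqType) (F G : T -> fps R) f g :
  hsum F f -> hsum G g -> hsum (fun x => F x - G x) (f - g).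
Proof. by move=> hf hg; apply: hsumD => //; apply: hsumN. Qed.

Lemma hsum_reindex (T U : eqType) (F : T -> fps R) (a : U -> T) (b : T -> U) f :
  cancel a b -> cancel b a -> hsum F f -> hsum (F \o a) f.
Proof.
move=> aK bK hf m; have [s [us s0 hs]] := hf m; exists (map b s); split.
- by rewrite map_inj_uniq //; apply: can_inj bK.
- move=> x hx; apply: s0; apply: contra hx => hx; apply/mapP; exists (a x) => //.
- rewrite big_map; apply: eqm_trans hs; rewrite (eq_bigr F) // => x _ /=.
  by rewrite bK.
Qed.

Lemma hsumM (T U : eqType) (F : T -> fps R) (G : U -> fps R) f g :
  hsum F f -> hsum G g -> hsum (fun xy => F xy.1 * G xy.2) (f * g).
Proof.
move=> hf hg m; have [s [us s0 hs]] := hf m; have [t [ut t0 ht]] := hg m.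
exists [seq (x, y) | x <- s, y <- t]; split.
- by apply: allpairs_uniq => // -[x y] [x' y'].
- move=> [x y] /=; case: (boolP (x \in s)) => [xs|/s0 h _]; last exact: eqmM0l.
  case: (boolP (y \in t)) => [yt|/t0 h _]; last exact: eqmM0r.
  by rewrite allpairs_f.
- rewrite big_allpairs_dep /=; apply: eqm_trans (eqmM hs ht).
  rewrite mulr_suml; apply: eqm_sum => x _.
  by rewrite mulr_sumr.
Qed.

(** Fubini: modulo a fixed power, all inner sums run over one common finite list [sy], because the
    double family vanishes outside [s]. *)
Lemma hsum_sigma (T U : eqType) (F : T * U -> fps R) (G : T -> fps R) f :
  hsum F f -> (forall x, hsum (fun y => F (x, y)) (G x)) -> hsum G f.
Proof.
move=> hf hG m; have [s [us s0 hs]] := hf m.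
pose sx := undup (map fst s); pose sy := undup (map snd s).
have out_y x y : y \notin sy -> eqm m (F (x, y)) 0.
  move=> hy; apply: s0; apply: contra hy => hy; rewrite mem_undup.
  by apply/mapP; exists (x, y).
have Gsy x : eqm m (G x) (\sum_(y <- sy) F (x, y)).
  have [t [ut t0 ht]] := hG x m; apply: eqm_trans (eqm_sym ht) _.
  by apply: eqm_sum_support => // [|y]; [apply: undup_uniq | apply: out_y].
exists sx; split; first exact: undup_uniq.
- move=> x hx; apply: eqm_trans (Gsy x) _.
  apply: eqm_sum0 => y _; apply: s0; apply: contra hx => hx; rewrite mem_undup.
  by apply/mapP; exists (x, y).
- apply: eqm_trans hs; apply: eqm_trans (eqm_sum (P := xpredT) _ (fun x _ => Gsy x)) _.
  rewrite -big_allpairs.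
  apply: eqm_sum_subset => //.
    by apply: allpairs_uniq; rewrite ?undup_uniq // => -[x y] [x' y'].
  move=> [x y] hxy; apply/allpairsP; exists (x, y).
  by split=> //; rewrite mem_undup; apply/mapP; exists (x, y).
Qed.

(* Tannery's theorem. *)
Lemma dominated_hsum (T : eqType) (F : nat -> T -> fps R) (G : T -> fps R)
    (u : nat -> fps R) :
  (forall m, exists s : seq T, forall x, x \notin s -> forall n, eqm m (F n x) 0) ->
  (forall n, hsum (F n) (u n)) -> (forall x, fps_cvg (F^~ x) (G x)) ->
  forall m, exists s : seq T, exists N,
    [/\ uniq s, forall x, x \notin s -> eqm m (G x) 0
      & forall n, (N <= n)%N -> eqm m (u n) (\sum_(x <- s) G x)].
Proof.
move=> dom hF cF m; have [s' s0'] := dom m; pose s := undup s'.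
have s0 x : x \notin s -> forall n, eqm m (F n x) 0.
  by rewrite mem_undup; apply: s0'.
have us : uniq s by apply: undup_uniq.
have [N hN] : exists N, forall n, (N <= n)%N ->
    eqm m (\sum_(x <- s) F n x) (\sum_(x <- s) G x).
  have /fps_cvgP/(_ m) : fps_cvg (fun n => \sum_(x <- s) F n x) (\sum_(x <- s) G x).
    elim: (s) => [|x t IHt].
      by move=> n; exists 0%N => k _; rewrite !big_nil.
    have := fps_cvgD (cF x) IHt => h n; have [N hN] := h n.
    by exists N => k le_k; rewrite !big_cons hN.
  by [].
exists s, N; split=> // [x hx | n le_Nn].
  have /fps_cvgP/(_ m)[M hM] := cF x.
  exact: eqm_trans (eqm_sym (hM _ (leqnn M))) (s0 x hx M).
apply: eqm_trans (hN n le_Nn); have [t [ut t0 ht]] := hF n m.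
apply: eqm_trans (eqm_sym ht) _.
by apply: eqm_sum_support => // x /s0; apply.
Qed.

Lemma dominated_cvg (T : eqType) (F : nat -> T -> fps R) (G : T -> fps R)
    (u : nat -> fps R) f :
  (forall m, exists s : seq T, forall x, x \notin s -> forall n, eqm m (F n x) 0) ->
  (forall n, hsum (F n) (u n)) -> (forall x, fps_cvg (F^~ x) (G x)) ->
  hsum G f -> fps_cvg u f.
Proof.
move=> dom hF cF hG; apply/fps_cvgP => m.
have [s [N [us s0 hN]]] := dominated_hsum dom hF cF m.
exists N => n /hN h; apply: eqm_trans h _; have [t [ut t0 ht]] := hG m.
apply: eqm_trans ht.
exact: eqm_sum_support.
Qed.

(** Here the limit of the sums is known and yields the sum of the limits; in this direction a finite
    identity gives an infinite one. *)
Lemma cvg_dominated_hsum (T : eqType) (F : nat -> T -> fps R) (G : T -> fps R)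
    (u : nat -> fps R) f :
  (forall m, exists s : seq T, forall x, x \notin s -> forall n, eqm m (F n x) 0) ->
  (forall n, hsum (F n) (u n)) -> (forall x, fps_cvg (F^~ x) (G x)) ->
  fps_cvg u f -> hsum G f.
Proof.
move=> dom hF cF /fps_cvgP cu m.
have [s [N [us s0 hN]]] := dominated_hsum dom hF cF m.
exists s; split=> //; have [M hM] := cu m.
apply: eqm_trans (hM _ (leq_maxr N M)); apply: eqm_sym.
exact: hN (leq_maxl N M).
Qed.

(** Coefficient [k] is read off from the terms up to [k], which is right when each [u n] is
    divisible by the n-th power of the variable. *)
Definition nat_sum (u : nat -> fps R) : fps R :=
  Fps (fun k => fcoef (\sum_(n <- iota 0 k.+1) u n) k).

Lemma hsum_nat (u : nat -> fps R) :
  (forall n, eqm n (u n) 0) -> hsum u (nat_sum u).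
Proof.
move=> hu m.
have out k x : x \notin iota 0 k -> eqm k (u x) 0.
  by rewrite mem_iota add0n /= -leqNgt => /eqmW; apply.
exists (iota 0 m); split; [exact: iota_uniq | exact: out | move=> k lt_km /=].
apply: (eqm_sum_subset (iota_uniq _ _) (iota_uniq _ _) _ (@out k.+1)) => // x.
by rewrite !mem_iota !add0n => /leq_trans; apply.
Qed.

Lemma hsum_has_sum (u : nat -> fps R) f : hsum u f -> fps_has_sum u f.
Proof.
move=> hu; apply/fps_cvgP => m; have [s [us s0 hs]] := hu m.
exists (foldr maxn 0 s).+1 => n lt_n; apply: eqm_trans hs.
apply: eqm_sum_subset => // [|x xs]; first exact: iota_uniq.
rewrite mem_index_iota /=; apply: leq_ltn_trans lt_n.
elim: s xs {us s0} => // y s IHs; rewrite inE => /predU1P[->|/IHs h] /=.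
  exact: leq_maxl.
by rewrite leq_max h orbT.
Qed.

Lemma hsum_shift (u : nat -> fps R) f : hsum u f ->
  hsum (fun n => if n is n'.+1 then u n' else 0) f.
Proof.
move=> hu m; have [s [us s0 hs]] := hu m; exists (map S s); split.
- by rewrite map_inj_uniq // => x y [].
- by case=> // n hn; apply: s0; apply: contra hn; apply: map_f.
- by rewrite big_map.
Qed.

End HasSum.

(** Once the finite support is closed under [r], the sum equals its own negative, and an integer
    equal to its negative is zero. *)
Lemma hsum_odd (T : eqType) (F : T -> fps int) (r : T -> T) :
  (forall m, exists s : seq T, forall x, x \notin s -> eqm m (F x) 0) ->
  involutive r -> (forall x, F (r x) = - F x) -> hsum F 0.
Proof.
move=> lf rK hr m; have [s s0] := lf m; pose t := undup (s ++ map r s).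
have t0 x : x \notin t -> eqm m (F x) 0.
  by rewrite mem_undup mem_cat negb_or => /andP[/s0].
exists t; split=> //; first exact: undup_uniq.
have tr : perm_eq (map r t) t.
  apply: uniq_perm; rewrite ?map_inj_uniq ?undup_uniq //; first exact: can_inj rK.
  have mr u y : (y \in map r u) = (r y \in u).
    by rewrite -{1}(rK y) (mem_map (can_inj rK)).
  by move=> x; rewrite mr !mem_undup !mem_cat !mr rK orbC.
suff -> : \sum_(x <- t) F x = 0 by [].
set w := \sum_(x <- t) F x; have w0 : w = - w.
  by rewrite {1}/w -(perm_big _ tr) big_map /= -sumrN; apply: eq_bigr => x _.
apply: fpsP => k; have := congr1 (fun f => fcoef f k) w0 => /=.
by move: (fcoef w k) => x; lia.
Qed.

(** * q-shifted factorials and Gaussian binomials *)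

Section Pochhammer.
Variable R : comUnitRingType.
Implicit Types a Q : fps R.

Lemma qpochS a Q n : qpoch a Q n.+1 = qpoch a Q n * (1 - a * Q ^+ n).
Proof. by rewrite /qpoch big_nat_recr. Qed.

Lemma qpoch0 a Q : qpoch a Q 0 = 1.
Proof. by rewrite /qpoch big_nil. Qed.

Lemma fcoef0M (f g : fps R) : fcoef (f * g) 0 = fcoef f 0 * fcoef g 0.
Proof. by rewrite fcoefM big_ord1. Qed.

Lemma fcoef0_qpoch a Q n : fcoef a 0 = 0 -> fcoef (qpoch a Q n) 0 = 1.
Proof.
move=> a0; elim: n => [|n IHn]; first by rewrite qpoch0.
by rewrite qpochS fcoef0M IHn mul1r fcoefB fcoef0M a0 mul0r subr0.
Qed.

Lemma qpoch_unit a Q n : fcoef a 0 = 0 -> qpoch a Q n \is a GRing.unit.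
Proof. by move=> a0; rewrite fps_unitE fcoef0_qpoch // unitr1. Qed.

Lemma fcoef0_qpoch_inf a Q : fcoef Q 0 = 0 -> fcoef a 0 = 0 ->
  fcoef (qpoch_inf a Q) 0 = 1.
Proof.
move=> Q0 a0; have [N hN] := qpoch_inf_cvg a Q0 0.
by rewrite -(hN N) // fcoef0_qpoch.
Qed.

Lemma qpoch_inf_unit a Q : fcoef Q 0 = 0 -> fcoef a 0 = 0 ->
  qpoch_inf a Q \is a GRing.unit.
Proof. by move=> Q0 a0; rewrite fps_unitE fcoef0_qpoch_inf // unitr1. Qed.

Lemma fcoef0X n : (0 < n)%N -> fcoef (fpsX ^+ n : fps R) 0 = 0.
Proof. by move=> n_gt0; rewrite -[_ ^+ _]mulr1 fcoefXnM n_gt0. Qed.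

End Pochhammer.

#[local] Hint Extern 0 (is_true (_ \is a GRing.unit)) =>
  (solve [apply: qpoch_unit => //; apply: fcoef0X => //
         |apply: qpoch_inf_unit => //; apply: fcoef0X => //]) : core.

Section Gauss.
Variables (R : comUnitRingType) (Q : fps R).
Hypothesis Q0 : fcoef Q 0 = 0.

(** Expresses consecutive inverses through a single one, which [ring] can then treat as an atom. *)
Lemma qpochV n : (qpoch Q Q n)^-1 = (qpoch Q Q n.+1)^-1 * (1 - Q ^+ n.+1).
Proof.
by apply: (mulrI (qpoch_unit Q n.+1 Q0)); rewrite mulVKr // qpochS mulrAC mulrV ?mul1r -?exprS.
Qed.

Lemma gauss_small n k : (n < k)%N -> gauss_binom Q n k = 0.
Proof. by move=> lt_nk; rewrite /gauss_binom leqNgt lt_nk. Qed.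

Lemma gauss0 n : gauss_binom Q n 0 = 1.
Proof. by rewrite /gauss_binom /= subn0 qpoch0 mul1r divrr. Qed.

Lemma gaussnn n : gauss_binom Q n n = 1.
Proof. by rewrite /gauss_binom leqnn subnn qpoch0 mulr1 divrr. Qed.

Lemma gaussE k j : gauss_binom Q (k + j) k =
  qpoch Q Q (k + j) * (qpoch Q Q k)^-1 * (qpoch Q Q j)^-1.
Proof. by rewrite /gauss_binom leq_addr addKn invrM // mulrA mulrAC. Qed.

Let gaussE1 k j : gauss_binom Q (k.+1 + j).+1 k.+1 =
  qpoch Q Q (k.+1 + j).+1 * (qpoch Q Q k.+1)^-1 * (qpoch Q Q j.+1)^-1.
Proof. by rewrite -addnS gaussE. Qed.

Let gaussE2 k j : gauss_binom Q (k.+1 + j) k =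
  qpoch Q Q (k.+1 + j) * (qpoch Q Q k)^-1 * (qpoch Q Q j.+1)^-1.
Proof. by rewrite addSnnS gaussE. Qed.

Lemma gaussS n k :
  gauss_binom Q n.+1 k.+1 = gauss_binom Q n k + Q ^+ k.+1 * gauss_binom Q n k.+1.
Proof.
case: (ltngtP n k) => [lt_nk|lt_kn|->].
- by rewrite !gauss_small ?mulr0 ?addr0 // ltnW.
- have [j ->] : exists j, n = (k.+1 + j)%N by exists (n - k.+1)%N; rewrite subnKC.
  by rewrite gaussE gaussE1 gaussE2 qpochS (qpochV k) (qpochV j) -exprS -addnS exprD; ring.
- by rewrite !gaussnn gauss_small ?mulr0 ?addr0.
Qed.

Lemma gaussS' n k : (k <= n)%N ->
  gauss_binom Q n.+1 k.+1 = gauss_binom Q n k.+1 + Q ^+ (n - k) * gauss_binom Q n k.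
Proof.
rewrite leq_eqVlt => /predU1P[->|lt_kn].
  by rewrite !gaussnn gauss_small ?subnn ?mulr1 ?add0r.
have [j ->] : exists j, n = (k.+1 + j)%N by exists (n - k.+1)%N; rewrite subnKC.
rewrite gaussE gaussE1 gaussE2 qpochS (qpochV k) (qpochV j) -exprS -addnS exprD.
by rewrite addSnnS addKn; ring.
Qed.

Lemma gauss_absorb n k :
  (1 - Q ^+ k.+1) * gauss_binom Q n.+1 k.+1 = (1 - Q ^+ n.+1) * gauss_binom Q n k.
Proof.
case: (leqP k n) => [le_kn|lt_nk]; last by rewrite !gauss_small ?mulr0.
have [j ->] : exists j, n = (k + j)%N by exists (n - k)%N; rewrite subnKC.
by rewrite -addSn !gaussE (qpochV k) addSn qpochS -exprS; ring.
Qed.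

Lemma gauss_sum (t : nat -> fps R) n :
  \sum_(0 <= s < n.+2) t s * gauss_binom Q n.+1 s =
  \sum_(0 <= s < n.+1) t s * Q ^+ s * gauss_binom Q n s
  + \sum_(0 <= s < n.+1) t s.+1 * gauss_binom Q n s.
Proof.
rewrite big_nat_recl // gauss0 mulr1.
under eq_bigr do rewrite gaussS mulrDr mulrA.
rewrite big_split addrCA [RHS]addrC; congr (_ + _).
rewrite [RHS]big_nat_recl // gauss0 expr0 !mulr1; congr (_ + _).
by rewrite big_nat_recr //= gauss_small ?mulr0 ?addr0.
Qed.

Lemma gauss_sum' (t : nat -> fps R) n :
  \sum_(0 <= s < n.+2) t s * gauss_binom Q n.+1 s =
  \sum_(0 <= s < n.+1) t s * gauss_binom Q n s
  + \sum_(0 <= s < n.+1) t s.+1 * Q ^+ (n - s) * gauss_binom Q n s.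
Proof.
rewrite big_nat_recl // gauss0 mulr1.
under eq_big_nat => s /andP[_ lt_s] do rewrite gaussS' // mulrDr mulrA.
rewrite big_split /= addrA; congr (_ + _).
rewrite [RHS]big_nat_recl // gauss0 mulr1; congr (_ + _).
by rewrite big_nat_recr //= gauss_small ?mulr0 ?addr0.
Qed.

(** The homogeneous form permits the substitution Y = Q^n, which keeps negative powers of q out of
    the triple product. *)
Lemma q_binomial Y Z n :
  \prod_(0 <= k < n) (Y - Z * Q ^+ k) =
  \sum_(0 <= s < n.+1)
     (-1) ^+ s * Q ^+ 'C(s, 2) * Z ^+ s * Y ^+ (n - s) * gauss_binom Q n s.
Proof.
elim: n => [|n IHn].
  by rewrite big_nil big_nat1 gauss0 bin0n !expr0 !mulr1.
rewrite big_nat_recr //= {}IHn gauss_sum' mulrBr; congr (_ + _).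
  rewrite mulr_suml; apply: eq_big_nat => s /andP[_ le_sn].
  by rewrite subSn // exprS; ring.
rewrite mulr_suml -sumrN; apply: eq_big_nat => s /andP[_ le_sn].
have -> : Q ^+ n = Q ^+ (n - s) * Q ^+ s by rewrite -exprD subnK.
by rewrite subSS binS bin1 exprD !exprS; ring.
Qed.

End Gauss.

(** * The Jacobi triple product *)

Local Notation q := (fpsX : fps int).

(** Integer exponents give [lia] and [ring] access to the exponent arithmetic. Negative exponents
    receive a default value, hence the hypotheses of [qzD]. *)
Definition qz (e : int) : fps int := q ^+ `|e|%N.
Definition zsign (j : int) : fps int := (-1) ^+ `|j|%N.
Definition tri (j : int) : int := ((j * (j - 1)) %/ 2)%Z.
Definition zrange (M : nat) : seq int := [seq (Posz k - Posz M) | k <- index_iota 0 (2 * M).+1].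

Lemma qzD e f : 0 <= e -> 0 <= f -> qz (e + f) = qz e * qz f.
Proof. by move=> e0 f0; rewrite /qz -exprD; congr (_ ^+ _); lia. Qed.

Lemma qzn (n : nat) : qz n = q ^+ n. Proof. by []. Qed.

Lemma eqm_qz m e f : (m <= `|e|)%N -> eqm m (qz e * f) 0.
Proof. exact: eqm_X. Qed.

Lemma zsignD i j : zsign (i + j) = zsign i * zsign j.
Proof.
rewrite /zsign -exprD -signr_odd -[RHS]signr_odd; congr (_ ^+ nat_of_bool _); lia.
Qed.

Lemma tri_eq j : 2 * tri j = j * (j - 1).
Proof.
rewrite /tri; have := divz_eq j 2; have : (j %% 2)%Z = 0 \/ (j %% 2)%Z = 1 by lia.
move: (j %/ 2)%Z (j %% 2)%Z => k r hr ->; nia.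
Qed.

Lemma tri_bin (n : nat) : tri n = 'C(n, 2).
Proof.
have := tri_eq n; elim: n => [|n IHn]; first by rewrite bin0n; lia.
by rewrite binS bin1; have := IHn (tri_eq n); have := tri_eq n; nia.
Qed.

Lemma mem_zrange M j : (j \in zrange M) = (`|j| <= M)%N.
Proof.
apply/mapP/idP => [[k]|h]; first by rewrite mem_index_iota => h ->; lia.
by exists `|(j + Posz M)%R|%N; rewrite ?mem_index_iota; lia.
Qed.

Lemma zrange_uniq M : uniq (zrange M).
Proof. by rewrite map_inj_uniq ?iota_uniq // => i j; lia. Qed.

Section JacobiTriple.
Variables (b i : nat).
Hypothesis i_gt0 : (0 < i)%N.
Hypothesis lt_ib : (i < b)%N.

Let Q : fps int := q ^+ b.

Let Q0 : fcoef Q 0 = 0.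
Proof. by apply: fcoef0X; apply: leq_ltn_trans lt_ib. Qed.

Definition jexp (j : int) : int := Posz b * tri j + Posz i * j.

(** This bound gives both the nonnegativity of the theta exponents and the local finiteness of the
    theta series. *)
Lemma jexp_ge (j : int) : `|j| <= jexp j.
Proof.
rewrite /jexp; have h := tri_eq j; case: (lerP 0 j) => j0.
  have : 0 <= tri j by nia.
  nia.
have : - j <= tri j by nia.
nia.
Qed.

Definition gaussz n (j : int) : fps int :=
  if 0 <= Posz n + j then gauss_binom Q (2 * n) `|(Posz n + j)%R|%N else 0.

Lemma prod_qX n :
  \prod_(0 <= k < n) q ^+ (i + b * k) = q ^+ (i * n + b * 'C(n, 2)).
Proof.
elim: n => [|n IHn]; first by rewrite big_nil !muln0.
by rewrite big_nat_recr //= IHn -exprD binS bin1; congr (_ ^+ _); lia.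
Qed.

(** For k < n a factor -q^(i + b k) is pulled out, which leaves (q^(b-i);Q)_n in reverse order; for
    k >= n a factor Q^n is pulled out, which leaves (q^i;Q)_n. *)
Lemma prod_shift n :
  \prod_(0 <= k < 2 * n) (Q ^+ n - q ^+ i * Q ^+ k) =
  (-1) ^+ n * q ^+ (b * n * n + (i * n + b * 'C(n, 2))) *
    (qpoch (q ^+ i) Q n * qpoch (q ^+ (b - i)) Q n).
Proof.
rewrite (@big_cat_nat _ _ _ n) //=; last by lia.
have -> : \prod_(0 <= k < n) (Q ^+ n - q ^+ i * Q ^+ k) =
    (-1) ^+ n * q ^+ (i * n + b * 'C(n, 2)) * qpoch (q ^+ (b - i)) Q n.
  rewrite -prod_qX /qpoch [X in _ = _ * X]big_nat_rev add0n /=.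
  have <- : \prod_(0 <= k < n) (-1 : fps int) = (-1) ^+ n.
    by rewrite prodr_const_nat subn0.
  rewrite -!big_split /=; apply: eq_big_nat => k /andP[_ lt_kn].
  rewrite mulN1r mulrBr mulr1 mulNr opprK [RHS]addrC mulrA -!exprM -!exprD; congr (q ^+ _ - q ^+ _); nia.
have -> : \prod_(n <= k < 2 * n) (Q ^+ n - q ^+ i * Q ^+ k) =
    q ^+ (b * n * n) * qpoch (q ^+ i) Q n.
  rewrite -{1}(add0n n) big_addn.
  have -> : (2 * n - n)%N = n by lia.
  have <- : \prod_(0 <= k < n) q ^+ (b * n) = q ^+ (b * n * n).
    by rewrite prodr_const_nat subn0 -exprM.
  rewrite /qpoch -big_split /=.
  apply: eq_big_nat => k _.
  by rewrite mulrBr mulr1 -!exprM -!exprD; congr (q ^+ _ - q ^+ _); lia.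
by rewrite [q ^+ (b * n * n + _)]exprD; ring.
Qed.

(** The q-binomial theorem with 2n factors, Y = Q^n and Z = q^i, its index centred as j = s - n.
    Both sides are multiplied by the sign and monomial of [prod_shift], which are cancelled at the
    start. *)
Lemma finite_jtp n :
  \sum_(j <- zrange n) zsign j * qz (jexp j) * gaussz n j =
  qpoch (q ^+ i) Q n * qpoch (q ^+ (b - i)) Q n.
Proof.
have sgU : ((-1) ^+ n : fps int) \is a GRing.unit by rewrite unitrX // unitrN unitr1.
apply: (@fpsXn_inj _ (b * n * n + (i * n + b * 'C(n, 2)))).
apply: (mulrI sgU); rewrite /= [LHS]mulrA [RHS]mulrA -prod_shift (q_binomial Q0).
rewrite big_map mulr_sumr; apply: eq_big_nat => s /andP[_ lt_s].
rewrite /gaussz ifT; last by lia.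
have -> : `|(Posz n + (Posz s - Posz n))%R|%N = s by lia.
rewrite !mulrA; congr (_ * _).
have -> : (-1) ^+ s = zsign (Posz s - Posz n) * (-1) ^+ n.
  rewrite -[(-1) ^+ n]/(zsign n) -zsignD; congr (_ ^+ _); lia.
rewrite -!exprM -!mulrA -!exprD [RHS]mulrCA; congr (_ * _).
rewrite [LHS]mulrCA /qz -exprD; congr (_ * _ ^+ _).
have e : Posz 'C(s, 2) = Posz 'C(n, 2) + Posz n * (Posz s - Posz n) + tri (Posz s - Posz n).
  by have := tri_eq (Posz s - Posz n); have := tri_eq s; have := tri_eq n; rewrite !tri_bin; nia.
have j_ge0 := jexp_ge (Posz s - Posz n); apply/eqP; rewrite -(eqr_nat int) !natz.
rewrite !PoszD !PoszM gez0_abs; last by lia.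
by rewrite e /jexp -(@subzn (2 * n) s) ?PoszM //; apply/eqP; ring.
Qed.

(** For n >= |j| the coefficient is (Q;Q)_(2n) / ((Q;Q)_(n+j) (Q;Q)_(n-j)), and all three factorials
    tend to (Q;Q)_oo. *)
Lemma gaussz_cvg j : fps_cvg (gaussz ^~ j) (qpoch_inf Q Q)^-1.
Proof.
have ev (s : nat -> nat) : (forall n, (n <= s n + `|j|)%N) ->
    fps_cvg (fun n => qpoch Q Q (s n)) (qpoch_inf Q Q).
  move=> hs n; have [N h] := qpoch_inf_cvg Q Q0 n.
  by exists (N + `|j|)%N => m le_m; apply: h; have := hs m; lia.
have c1 := ev (fun n => 2 * n)%N ltac:(lia).
have c2 := ev (fun n => `|(Posz n + j)%R|%N) ltac:(lia).
have c3 := ev (fun n => `|(Posz n - j)%R|%N) ltac:(lia).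
have U : qpoch_inf Q Q \is a GRing.unit by exact: qpoch_inf_unit.
have uU n : qpoch Q Q n \is a GRing.unit by exact: qpoch_unit.
have := fps_cvgM c1 (fps_cvgM (fps_cvgV (fun n => uU _) U c2) (fps_cvgV (fun n => uU _) U c3)).
rewrite mulVKr // => h n; have [N hN] := h n.
exists (N + `|j|)%N => m le_m; rewrite -(hN m); last by lia.
rewrite /gaussz ifT; last by lia.
have -> : (2 * m = `|(Posz m + j)%R| + `|(Posz m - j)%R|)%N by lia.
by rewrite gaussE // mulrA.
Qed.

Lemma jacobi_triple : hsum (fun j => zsign j * qz (jexp j))
  (qpoch_inf (q ^+ i) Q * qpoch_inf (q ^+ (b - i)) Q * qpoch_inf Q Q).
Proof.
have U : qpoch_inf Q Q \is a GRing.unit by exact: qpoch_inf_unit.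
apply: (eq_hsum (F := fun j => zsign j * qz (jexp j) * (qpoch_inf Q Q)^-1 * qpoch_inf Q Q)).
  by move=> j; rewrite mulrVK.
apply: hsumMr.
apply: (@cvg_dominated_hsum _ _ (fun n j => zsign j * qz (jexp j) * gaussz n j) _
  (fun n => qpoch (q ^+ i) Q n * qpoch (q ^+ (b - i)) Q n)).
- move=> m; exists (zrange m) => j hj n; rewrite -mulrA; apply: eqmM0r.
  apply: eqm_qz; have := jexp_ge j; move: hj; rewrite mem_zrange; lia.
- move=> n; rewrite -finite_jtp; apply: hsum_finite; first exact: zrange_uniq.
  move=> j; rewrite mem_zrange => hj; rewrite /gaussz; case: ifP => h; rewrite ?mulr0 //.
  by rewrite gauss_small ?mulr0 //; lia.
- move=> j; apply: fps_cvgM; [exact: fps_cvg_const | exact: gaussz_cvg].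
- by apply: fps_cvgM; apply: qpoch_inf_cvg.
Qed.

End JacobiTriple.

(** * The double sums and their contiguous relations *)

Definition qexp (a b n s : nat) : nat := (n ^ 2 + s ^ 2 - n * s + a * n + b * s)%N.

(** The subtraction in [qexp] never truncates, as n s <= n^2 + s^2; exponents are compared in this
    integer form. *)
Lemma qexpE (a b n s : nat) :
  Posz (qexp a b n s) = Posz n * Posz n + Posz s * Posz s - Posz n * Posz s
    + Posz a * Posz n + Posz b * Posz s.
Proof.
rewrite /qexp !expnS !expn0 !muln1.
have : (n * s <= n * n + s * s)%N by nia.
lia.
Qed.

Definition dsum_coef (m a b n : nat) : fps int :=
  \sum_(0 <= s < (2 * n + m).+1)
    q ^+ qexp a b n s / qpoch q q n * gauss_binom q (2 * n + m) s.

(* The outer variable z is the indeterminate of the power series ring over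
   [fps int]; [qc] is the constant series q. *)
Definition dsum m a b : fps (fps int) := Fps (dsum_coef m a b).
Definition qc : fps (fps int) := Fps (fun n => if n is 0 then q else 0).
Local Notation z := (fpsX : fps (fps int)).

Lemma fcoefD (R : zmodType) (f g : fps R) n :
  fcoef (f + g) n = fcoef f n + fcoef g n.
Proof. by []. Qed.

Lemma fcoef_qcM k (F : fps (fps int)) n :
  fcoef (qc ^+ k * F) n = q ^+ k * fcoef F n.
Proof.
elim: k => [|k IHk]; first by rewrite !mul1r.
rewrite exprS -mulrA fcoefM big_ord_recl subn0 IHk big1 => [|i _].
  by rewrite addr0 mulrA exprS.
by rewrite mul0r.
Qed.

Lemma fcoef_zM (F : fps (fps int)) n :
  fcoef (z * F) n = if n is n'.+1 then fcoef F n' else 0.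
Proof. exact: fcoefXM. Qed.

(** In the part of Pascal's rule with reduced lower index, s becomes s + 1, and the cross term -n s
    lowers the coefficient of n by one; hence [a.+1] on the left. *)
Lemma dsum_pascal m a b :
  dsum m.+1 a.+1 b = dsum m a.+1 b.+1 + qc ^+ b.+1 * dsum m a b.+2.
Proof.
apply: fpsP => n; rewrite fcoefD fcoef_qcM /= /dsum_coef addnS.
rewrite (@gauss_sum _ q erefl (fun s => q ^+ qexp a.+1 b n s / qpoch q q n)).
rewrite mulr_sumr; congr (_ + _); apply: eq_bigr => s _.
  congr (_ * _); rewrite mulrAC -exprD; congr (q ^+ _ / _).
  by have := qexpE a.+1 b n s; have := qexpE a.+1 b.+1 n s; lia.
rewrite !mulrA -exprD; congr (q ^+ _ / _ * _).
by have := qexpE a.+1 b n s.+1; have := qexpE a b.+2 n s; lia.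
Qed.

Lemma dsum_pascal' m a b :
  dsum m.+1 a b = dsum m a b + qc ^+ (m.+1 + b) * dsum m a.+1 b.+1.
Proof.
apply: fpsP => n; rewrite fcoefD fcoef_qcM /= /dsum_coef addnS.
rewrite (@gauss_sum' _ q erefl (fun s => q ^+ qexp a b n s / qpoch q q n)).
rewrite mulr_sumr; congr (_ + _); apply: eq_big_nat => s /andP[_ le_s].
rewrite mulrA; congr (_ * _); rewrite mulrA mulrAC -!exprD; congr (q ^+ _ / _).
by have := qexpE a b n s.+1; have := qexpE a.+1 b.+1 n s; lia.
Qed.

(** The difference of the two series carries 1 - q^n, which cancels the last factor of (q;q)_n. The
    term n = 0 drops out, and shifting n produces z and raises the top index by 2. *)
Lemma dsum_outer m a b :
  dsum m a b.+1 = dsum m a.+1 b.+1 + z * (qc ^+ a.+1 * dsum m.+2 a.+2 b).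
Proof.
apply: fpsP => n; rewrite fcoefD fcoef_zM; case: n => [|n].
  by rewrite addr0 /= /dsum_coef; apply: eq_bigr => s _; rewrite /qexp !muln0.
rewrite fcoef_qcM /= /dsum_coef.
have -> : (2 * n.+1 + m = 2 * n + m.+2)%N by lia.
rewrite mulr_sumr -big_split; apply: eq_bigr => s _ /=.
rewrite !mulrA -mulrDl; congr (_ * _); rewrite (@qpochV _ q erefl n).
have -> : qexp a.+1 b.+1 n.+1 s = (qexp a b.+1 n.+1 s + n.+1)%N.
  by have := qexpE a b.+1 n.+1 s; have := qexpE a.+1 b.+1 n.+1 s; lia.
rewrite -exprD; have -> : (a.+1 + qexp a.+2 b n s)%N = qexp a b.+1 n.+1 s.
  by have := qexpE a b.+1 n.+1 s; have := qexpE a.+2 b n s; lia.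
by rewrite exprD; ring.
Qed.

(** The difference carries 1 - q^s, which absorption turns into 1 - q^(2n) = (1 - q^n)(1 + q^n). The
    first factor cancels against (q;q)_n, the second gives the two summands. *)
Lemma dsum_inner a b : dsum 0 a b = dsum 0 a b.+1 +
  z * (qc ^+ (1 + a + b) * (dsum 1 a.+1 b.+1 + qc ^+ 1 * dsum 1 a.+2 b.+1)).
Proof.
apply: fpsP => n; rewrite fcoefD fcoef_zM; case: n => [|n].
  by rewrite addr0 /= /dsum_coef !big_nat1 /qexp !muln0.
rewrite fcoef_qcM; set F := dsum 1 a.+1 _; set G := dsum 1 a.+2 _.
rewrite fcoefD fcoef_qcM.
rewrite {}/F {}/G /= /dsum_coef !addn0.
have -> : (2 * n.+1 = (2 * n + 1).+1)%N by lia.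
rewrite big_nat_recl // [in RHS]big_nat_recl // -addrA; congr (_ + _).
rewrite mulr_sumr -big_split mulr_sumr -big_split; apply: eq_bigr => s _ /=.
have h := @gauss_absorb _ q erefl (2 * n + 1) s.
have -> : qexp a b.+1 n.+1 s.+1 = (qexp a b n.+1 s.+1 + s.+1)%N.
  by have := qexpE a b n.+1 s.+1; have := qexpE a b.+1 n.+1 s.+1; lia.
have -> : qexp a.+2 b.+1 n s = (qexp a.+1 b.+1 n s + n)%N.
  by have := qexpE a.+2 b.+1 n s; have := qexpE a.+1 b.+1 n s; lia.
have -> : qexp a b n.+1 s.+1 = (1 + a + b + qexp a.+1 b.+1 n s)%N.
  by have := qexpE a b n.+1 s.+1; have := qexpE a.+1 b.+1 n s; lia.
move: (qexp a.+1 b.+1 n s) => k; rewrite (@qpochV _ q erefl n) !(exprD q).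
set x := q ^+ k; set y := (qpoch _ _ _)^-1; set c := q ^+ 1 * _ * _.
set g' := gauss_binom q _ s.
have h2 : q ^+ (2 * n + 1).+1 = q ^+ n.+1 * q ^+ n.+1.
  by rewrite -exprD; congr (_ ^+ _); lia.
rewrite h2 in h; apply/eqP; rewrite addrC -subr_eq; apply/eqP.
transitivity (c * x * y * ((1 - q ^+ s.+1) * gauss_binom q (2 * n + 1).+1 s.+1)).
  by ring.
by rewrite h -/g' exprS expr1; ring.
Qed.

(** * The functional equations of the cylindric generating functions *)

(* [cylG_c] is the series attached to cylindric partitions of profile [c],
   for the five cyclic classes of profiles of rank 3 and level 4. *)
Definition cylG400 := dsum 0 1 1.
Definition cylG310 := dsum 0 0 1.
Definition cylG301 := dsum 0 1 0 + qc ^+ 1 * z * dsum 0 2 1.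
Definition cylG220 := dsum 0 1 0 + qc ^+ 1 * z * dsum 1 2 0.
Definition cylG211 := dsum 0 0 0.

(** The substitution of q z for z. *)
Definition qshift (F : fps (fps int)) : fps (fps int) :=
  Fps (fun n => q ^+ n * fcoef F n).

Lemma qshiftD F G : qshift (F + G) = qshift F + qshift G.
Proof. by apply: fpsP => n /=; rewrite mulrDr. Qed.

Lemma qshiftB F G : qshift (F - G) = qshift F - qshift G.
Proof. by apply: fpsP => n /=; rewrite mulrBr. Qed.

Lemma qshift1 : qshift 1 = 1.
Proof. by apply: fpsP => -[|n] /=; rewrite ?mul1r ?mulr0. Qed.

Lemma qshiftM F G : qshift (F * G) = qshift F * qshift G.
Proof.
apply: fpsP => n; rewrite -[LHS]/(_ * fcoef (F * G) n) !fcoefM mulr_sumr; apply: eq_bigr => i _ /=.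
have le_in : (i <= n)%N by rewrite -ltnS.
by rewrite -{1}(subnKC le_in) exprD; ring.
Qed.

Lemma qshift_z : qshift z = qc * z.
Proof.
apply: fpsP => n; rewrite -[qc]expr1 fcoef_qcM /=.
by case: n => [|[|n]]; rewrite ?mulr0.
Qed.

Lemma qshift_qc : qshift qc = qc.
Proof. by apply: fpsP => -[|n] /=; rewrite ?mul1r ?mulr0. Qed.

Lemma qshift_dsum m a b : qshift (dsum m a b) = dsum m a.+1 b.
Proof.
apply: fpsP => n /=; rewrite /dsum_coef mulr_sumr; apply: eq_bigr => s _.
rewrite !mulrA -exprD; congr (q ^+ _ / _ * _).
by have := qexpE a b n s; have := qexpE a.+1 b n s; lia.
Qed.

(** Euler's expansion of 1/(z;q)_oo in powers of z. *)
Definition qexp_series : fps (fps int) := Fps (fun n => (qpoch q q n)^-1).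
Local Notation e := qexp_series.

Lemma qshift_e : qshift e = (1 - z) * e.
Proof.
rewrite mulrBl mul1r; apply: fpsP => n; rewrite fcoefB fcoef_zM /=.
case: n => [|n]; first by rewrite mul1r subr0.
by rewrite (@qpochV _ q erefl n); ring.
Qed.

Lemma qshift_qcz k : qshift (qc ^+ k * z) = qc ^+ k.+1 * z.
Proof.
elim: k => [|k IHk]; first by rewrite expr0 mul1r qshift_z expr1.
by rewrite exprS -mulrA qshiftM IHk qshift_qc mulrA -exprS.
Qed.

Lemma qshift_comb k m a b m' a' b' :
  qshift (dsum m a b + qc ^+ k * z * dsum m' a' b') =
  dsum m a.+1 b + qc ^+ k.+1 * z * dsum m' a'.+1 b'.
Proof. by rewrite qshiftD [qshift (_ * dsum _ _ _)]qshiftM qshift_qcz !qshift_dsum. Qed.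

Lemma cylG310_eq : cylG310 =
  dsum 0 2 0 + z * (qc * dsum 1 2 0) + z * (qc ^+ 2 * dsum 1 3 0).
Proof.
rewrite /cylG310 (dsum_outer 0 0 0) (dsum_outer 0 1 0).
have h : dsum 0 2 0 = _ := dsum_inner 2 0.
rewrite h !(dsum_pascal' 1); ring.
Qed.

Lemma cylG211_eq : cylG211 =
  dsum 0 1 0 + z * (qc * (dsum 0 2 0 + dsum 0 1 1 + qc * dsum 1 3 0)).
Proof.
rewrite /cylG211 (dsum_inner 0 0) (dsum_inner 1 0) (dsum_outer 0 0 0).
rewrite (dsum_pascal' 1 2 0) (dsum_pascal 0 2 0) (dsum_pascal' 0 1 1) (dsum_pascal' 0 2 0); ring.
Qed.

(** The functional equations at z^(n+1): multiplication by z steps back to index n, and each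
    substitution of q z contributes a factor [t]. *)
Definition cyl_rec (u400 u310 u301 u220 u211 : nat -> fps int) := forall n,
  let t := q ^+ n.+1 in let m := n.+1 in
  [/\ u400 n = u400 m - t * u310 m,
      u310 n = u310 m - t * (u220 m + u301 m) + t ^+ 2 * u211 m,
      u301 n = u301 m - t * (u211 m + u400 m) + t ^+ 2 * u310 m,
      u220 n = u220 m - t * (u301 m + u211 m) + t ^+ 2 * u211 m
    & u211 n = u211 m - t * (u211 m + u220 m + u310 m)
        + t ^+ 2 * (u211 m + u301 m + u220 m) - t ^+ 3 * u211 m].

Definition cylH F : nat -> fps int := fcoef (F * e).

(** Every shifted series thus becomes a multiple of the same [e], and each functional equation
    reduces to a relation between double sums with polynomial coefficients. *)
Lemma qshift_eM F : qshift (F * e) = qshift F * (1 - z) * e.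
Proof. by rewrite qshiftM qshift_e mulrA. Qed.

Lemma qshift2_eM F :
  qshift (qshift (F * e)) = qshift (qshift F) * (1 - qc ^+ 1 * z) * (1 - z) * e.
Proof.
rewrite qshift_eM [LHS]qshiftM qshift_e [qshift (qshift F * _)]qshiftM.
by rewrite qshiftB qshift1 qshift_z !mulrA expr1.
Qed.

Lemma qshift3_eM F : qshift (qshift (qshift (F * e))) =
  qshift (qshift (qshift F)) * (1 - qc ^+ 2 * z) * (1 - qc ^+ 1 * z) * (1 - z) * e.
Proof.
rewrite qshift2_eM [LHS]qshiftM qshift_e [qshift (_ * (1 - z))]qshiftM.
rewrite [qshift (_ * (1 - qc ^+ 1 * z))]qshiftM.
by rewrite !qshiftB qshift1 qshift_qcz qshift_z !mulrA.
Qed.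

Lemma qshift_cylF400 : qshift (cylG400 * e) = dsum 0 2 1 * (1 - z) * e.
Proof. by rewrite qshift_eM qshift_dsum. Qed.

Lemma qshift_cylF310 : qshift (cylG310 * e) = dsum 0 1 1 * (1 - z) * e.
Proof. by rewrite qshift_eM qshift_dsum. Qed.

Lemma qshift_cylF301 : qshift (cylG301 * e) =
  (dsum 0 2 0 + qc ^+ 2 * z * dsum 0 3 1) * (1 - z) * e.
Proof. by rewrite qshift_eM qshift_comb. Qed.

Lemma qshift_cylF220 : qshift (cylG220 * e) =
  (dsum 0 2 0 + qc ^+ 2 * z * dsum 1 3 0) * (1 - z) * e.
Proof. by rewrite qshift_eM qshift_comb. Qed.

Lemma qshift_cylF211 : qshift (cylG211 * e) = dsum 0 1 0 * (1 - z) * e.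
Proof. by rewrite qshift_eM qshift_dsum. Qed.

Lemma qshift2_cylF310 : qshift (qshift (cylG310 * e)) =
  dsum 0 2 1 * (1 - qc ^+ 1 * z) * (1 - z) * e.
Proof. by rewrite qshift2_eM !qshift_dsum. Qed.

Lemma qshift2_cylF301 : qshift (qshift (cylG301 * e)) =
  (dsum 0 3 0 + qc ^+ 3 * z * dsum 0 4 1) * (1 - qc ^+ 1 * z) * (1 - z) * e.
Proof. by rewrite qshift2_eM !qshift_comb. Qed.

Lemma qshift2_cylF220 : qshift (qshift (cylG220 * e)) =
  (dsum 0 3 0 + qc ^+ 3 * z * dsum 1 4 0) * (1 - qc ^+ 1 * z) * (1 - z) * e.
Proof. by rewrite qshift2_eM !qshift_comb. Qed.

Lemma qshift2_cylF211 : qshift (qshift (cylG211 * e)) =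
  dsum 0 2 0 * (1 - qc ^+ 1 * z) * (1 - z) * e.
Proof. by rewrite qshift2_eM !qshift_dsum. Qed.

Lemma qshift3_cylF211 : qshift (qshift (qshift (cylG211 * e))) =
  dsum 0 3 0 * (1 - qc ^+ 2 * z) * (1 - qc ^+ 1 * z) * (1 - z) * e.
Proof. by rewrite qshift3_eM !qshift_dsum. Qed.

Lemma cylF400_eq :
  z * (cylG400 * e) = cylG400 * e - qshift (cylG310 * e).
Proof.
transitivity (cylG400 * e - dsum 0 1 1 * (1 - z) * e).
  by rewrite /cylG400; ring.
by congr (_ - _); rewrite qshift_cylF310.
Qed.

Lemma cylF310_eq : z * (cylG310 * e) = cylG310 * e
  - (qshift (cylG220 * e) + qshift (cylG301 * e)) + qshift (qshift (cylG211 * e)).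
Proof.
transitivity (cylG310 * e - ((dsum 0 2 0 + qc ^+ 2 * z * dsum 1 3 0) * (1 - z) * e
    + (dsum 0 2 0 + qc ^+ 2 * z * dsum 0 3 1) * (1 - z) * e)
    + dsum 0 2 0 * (1 - qc ^+ 1 * z) * (1 - z) * e).
  by rewrite cylG310_eq (dsum_pascal' 0 2 0); ring.
congr (_ - (_ + _) + _).
- by rewrite qshift_cylF220.
- by rewrite qshift_cylF301.
- by rewrite qshift2_cylF211.
Qed.

Lemma cylF301_eq : z * (cylG301 * e) = cylG301 * e
  - (qshift (cylG211 * e) + qshift (cylG400 * e)) + qshift (qshift (cylG310 * e)).
Proof.
transitivity (cylG301 * e - (dsum 0 1 0 * (1 - z) * e + dsum 0 2 1 * (1 - z) * e)
    + dsum 0 2 1 * (1 - qc ^+ 1 * z) * (1 - z) * e).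
  by rewrite /cylG301; ring.
congr (_ - (_ + _) + _).
- by rewrite qshift_cylF211.
- by rewrite qshift_cylF400.
- by rewrite qshift2_cylF310.
Qed.

Lemma cylF220_eq : z * (cylG220 * e) = cylG220 * e
  - (qshift (cylG301 * e) + qshift (cylG211 * e)) + qshift (qshift (cylG211 * e)).
Proof.
transitivity (cylG220 * e - ((dsum 0 2 0 + qc ^+ 2 * z * dsum 0 3 1) * (1 - z) * e
    + dsum 0 1 0 * (1 - z) * e)
    + dsum 0 2 0 * (1 - qc ^+ 1 * z) * (1 - z) * e).
  by rewrite /cylG220 (dsum_pascal' 0 2 0); ring.
congr (_ - (_ + _) + _).
- by rewrite qshift_cylF301.
- by rewrite qshift_cylF211.
- by rewrite qshift2_cylF211.
Qed.

(** The image of [cylG310_eq], an expansion of [dsum 0 0 1], under the substitution of q z for z. *)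
Lemma dsum_011_eq : dsum 0 1 1 =
  dsum 0 3 0 + qc ^+ 2 * z * dsum 1 3 0 + qc ^+ 3 * z * dsum 1 4 0.
Proof.
have h : dsum 0 0 1 = dsum 0 2 0 + qc ^+ 1 * z * dsum 1 2 0 + qc ^+ 2 * z * dsum 1 3 0.
  by have := cylG310_eq; rewrite /cylG310 => ->; ring.
have := congr1 qshift h; rewrite qshift_dsum => ->.
rewrite [LHS]qshiftD qshift_comb; congr (_ + _).
by rewrite qshiftM qshift_qcz qshift_dsum.
Qed.

Lemma cylF211_eq : z * (cylG211 * e) = cylG211 * e
  - (qshift (cylG211 * e) + qshift (cylG220 * e) + qshift (cylG310 * e))
  + (qshift (qshift (cylG211 * e)) + qshift (qshift (cylG301 * e))
     + qshift (qshift (cylG220 * e)))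
  - qshift (qshift (qshift (cylG211 * e))).
Proof.
transitivity (cylG211 * e - (dsum 0 1 0 * (1 - z) * e
      + (dsum 0 2 0 + qc ^+ 2 * z * dsum 1 3 0) * (1 - z) * e
      + dsum 0 1 1 * (1 - z) * e)
    + (dsum 0 2 0 * (1 - qc ^+ 1 * z) * (1 - z) * e
      + (dsum 0 3 0 + qc ^+ 3 * z * dsum 0 4 1) * (1 - qc ^+ 1 * z) * (1 - z) * e
      + (dsum 0 3 0 + qc ^+ 3 * z * dsum 1 4 0) * (1 - qc ^+ 1 * z) * (1 - z) * e)
    - dsum 0 3 0 * (1 - qc ^+ 2 * z) * (1 - qc ^+ 1 * z) * (1 - z) * e).
  by rewrite cylG211_eq dsum_011_eq (dsum_pascal' 0 3 0); ring.
congr (_ - _); last by rewrite qshift3_cylF211.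
congr (_ + _); [congr (_ - _); congr (_ + _); [congr (_ + _) |] |
  congr (_ + _); [congr (_ + _) |]].
- by rewrite qshift_cylF211.
- by rewrite qshift_cylF220.
- by rewrite qshift_cylF310.
- by rewrite qshift2_cylF211.
- by rewrite qshift2_cylF301.
- by rewrite qshift2_cylF220.
Qed.

Lemma fcoef_qshift F n : fcoef (qshift F) n = q ^+ n * fcoef F n.
Proof. by []. Qed.

Lemma fcoef_cyl_rec F1 F2 F3 F4 F5 :
  z * F1 = F1 - qshift F2 ->
  z * F2 = F2 - (qshift F4 + qshift F3) + qshift (qshift F5) ->
  z * F3 = F3 - (qshift F5 + qshift F1) + qshift (qshift F2) ->
  z * F4 = F4 - (qshift F3 + qshift F5) + qshift (qshift F5) ->
  z * F5 = F5 - (qshift F5 + qshift F4 + qshift F2)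
    + (qshift (qshift F5) + qshift (qshift F3) + qshift (qshift F4))
    - qshift (qshift (qshift F5)) ->
  cyl_rec (fcoef F1) (fcoef F2) (fcoef F3) (fcoef F4) (fcoef F5).
Proof.
move=> h1 h2 h3 h4 h5 n t m.
have cz F : fcoef F n = fcoef (z * F) m by rewrite fcoef_zM.
split; rewrite cz ?(h1, h2, h3, h4, h5) ?(fcoefB, fcoefD, fcoef_qshift) -/t; ring.
Qed.

Lemma cylH_rec :
  cyl_rec (cylH cylG400) (cylH cylG310) (cylH cylG301) (cylH cylG220) (cylH cylG211).
Proof.
exact: (fcoef_cyl_rec cylF400_eq cylF310_eq cylF301_eq cylF220_eq cylF211_eq).
Qed.

(** The power q^(n+1) has positive exponent, so multiplying by it gains one order of precision. *)
Lemma eqm_cyl_step k n f f' g g' : f = f' -> eqm k g g' ->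
  eqm k.+1 (f + q ^+ n.+1 * g) (f' + q ^+ n.+1 * g').
Proof.
move=> -> h; apply: eqmD => //; apply: (eqmW _ (eqmX (n := n.+1) h)).
by rewrite addSn ltnS leq_addl.
Qed.

Lemma cyl_rec_unique u1 u2 u3 u4 u5 v1 v2 v3 v4 v5 :
  cyl_rec u1 u2 u3 u4 u5 -> cyl_rec v1 v2 v3 v4 v5 ->
  [/\ u1 0%N = v1 0%N, u2 0%N = v2 0%N, u3 0%N = v3 0%N, u4 0%N = v4 0%N & u5 0%N = v5 0%N] ->
  forall n, [/\ u1 n = v1 n, u2 n = v2 n, u3 n = v3 n, u4 n = v4 n & u5 n = v5 n].
Proof.
move=> hu hv h0; elim=> // n [i1 i2 i3 i4 i5].
have [a1 a2 a3 a4 a5] := hu n; have [b1 b2 b3 b4 b5] := hv n.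
set t := q ^+ n.+1 in a1 a2 a3 a4 a5 b1 b2 b3 b4 b5.
(* The system is implicit in the entries of index n + 1, so agreement is proved by induction on the
   q-adic precision [k], after solving each equation for its leading entry. *)
suff h k : [/\ eqm k (u1 n.+1) (v1 n.+1), eqm k (u2 n.+1) (v2 n.+1),
    eqm k (u3 n.+1) (v3 n.+1), eqm k (u4 n.+1) (v4 n.+1)
    & eqm k (u5 n.+1) (v5 n.+1)].
  by split; apply: eqm_eq => k; have [] := h k.
elim: k => [|k [h1 h2 h3 h4 h5]]; first by split.
have e1 (x1 x2 y : fps int) : y = x1 - t * x2 -> x1 = y + t * x2.
  by move=> ->; ring.
have e2 (x1 x2 x3 y : fps int) :
  y = x1 - t * x2 + t ^+ 2 * x3 -> x1 = y + t * (x2 - t * x3).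
  by move=> ->; ring.
have e3 (x1 x2 x3 x4 y : fps int) :
  y = x1 - t * x2 + t ^+ 2 * x3 - t ^+ 3 * x4 ->
  x1 = y + t * (x2 - t * x3 + t ^+ 2 * x4).
  by move=> ->; ring.
split.
- by rewrite (e1 _ _ _ a1) (e1 _ _ _ b1); apply: eqm_cyl_step.
- rewrite (e2 _ _ _ _ a2) (e2 _ _ _ _ b2); apply: eqm_cyl_step => //.
  by do ?[apply: eqmD | apply: eqmN | apply: eqmM].
- rewrite (e2 _ _ _ _ a3) (e2 _ _ _ _ b3); apply: eqm_cyl_step => //.
  by do ?[apply: eqmD | apply: eqmN | apply: eqmM].
- rewrite (e2 _ _ _ _ a4) (e2 _ _ _ _ b4); apply: eqm_cyl_step => //.
  by do ?[apply: eqmD | apply: eqmN | apply: eqmM].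
- rewrite (e3 _ _ _ _ _ a5) (e3 _ _ _ _ _ b5); apply: eqm_cyl_step => //.
  by do ?[apply: eqmD | apply: eqmN | apply: eqmM].
Qed.

(** * The lattice-sum solution *)

Definition phi (m : int) : fps int :=
  if m is Posz k then (qpoch q q k)^-1 else 0.

Lemma phi_lt0 m : m < 0 -> phi m = 0. Proof. by case: m. Qed.

(** At m = 0 both sides vanish, in accordance with 1/(q;q)_m = 0 for negative m. *)
Lemma phi_pred m : 0 <= m -> phi (m - 1) = (1 - qz m) * phi m.
Proof.
case: m => [[|k] _|//]; first by rewrite /= subrr mul0r.
have -> : Posz k.+1 - 1 = Posz k by lia.
by rewrite /= qpochV // mulrC qzn.
Qed.

(* With x_j = d_j + j and d_1 + d_2 + d_3 = 0, [lsign] is the sign of the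
   permutation of the residues of x_1, x_2, x_3 modulo 3 (zero when two of them
   coincide), and [lnum d / 3] is (x_1^2 + x_2^2 + x_3^2 - 14) / 6.  The profile
   (c_1, c_2, c_3) corresponds to (a_1, a_2) = (c_2 + c_3 + 2, c_3 + 1). *)
Definition lsign (d : int * int) : fps int :=
  let K := ((2 * d.1 + d.2) %% 3)%Z in
  if K == 0 then 1 else if K == 1 then -1 else 0.
Definition lnum (d : int * int) : int :=
  d.1 * d.1 + d.1 * d.2 + d.2 * d.2 - 2 * d.1 - d.2.
Definition lexp (a1 a2 : int) (d : int * int) : int :=
  7 * (lnum d %/ 3)%Z + a1 * d.1 + a2 * d.2.

Variant lsign_spec (d : int * int) : fps int -> int -> Prop :=
| LsignPos (k : int) of 2 * d.1 + d.2 = 3 * k : lsign_spec d 1 0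
| LsignNeg (k : int) of 2 * d.1 + d.2 = 3 * k + 1 : lsign_spec d (-1) 1
| LsignZero (k : int) of 2 * d.1 + d.2 = 3 * k + 2 : lsign_spec d 0 2.

Lemma lsignP d : lsign_spec d (lsign d) ((2 * d.1 + d.2) %% 3)%Z.
Proof.
rewrite /lsign; have := divz_eq (2 * d.1 + d.2) 3.
have : ((2 * d.1 + d.2) %% 3)%Z = 0 \/ ((2 * d.1 + d.2) %% 3)%Z = 1 \/
  ((2 * d.1 + d.2) %% 3)%Z = 2 by lia.
move: (_ %% _)%Z (_ %/ _)%Z => r k [->|[->|->]] h /=.
- by apply: (@LsignPos _ k); lia.
- by apply: (@LsignNeg _ k); lia.
- by apply: (@LsignZero _ k); lia.
Qed.

Lemma lnum3 d : lsign d != 0 -> 3 * (lnum d %/ 3)%Z = lnum d.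
Proof.
move=> h; suff [m ->] : exists m, lnum d = m * 3 by rewrite mulzK // mulrC.
move: h; rewrite /lnum; case: lsignP => k hk; rewrite ?eqxx // => _.
  exists (d.1 * d.1 - 3 * k * d.1 + 3 * k * k - k).
  have -> : d.2 = 3 * k - 2 * d.1 by lia.
  by ring.
exists (d.1 * d.1 - (3 * k + 1) * d.1 + (3 * k + 1) * k).
have -> : d.2 = 3 * k + 1 - 2 * d.1 by lia.
by ring.
Qed.

(* Completing the square shows that, under this condition, 3 * lexp exceeds -3,
   hence that the integer lexp is nonnegative. *)
Definition alcove (a1 a2 : int) := let al := 3 * a1 - 14 in let be := 3 * a2 - 7 in
  al * al - al * be + be * be < 63.

Lemma lexp_ge0 a1 a2 d : alcove a1 a2 -> lsign d != 0 -> 0 <= lexp a1 a2 d.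
Proof.
move=> hc hd; have := lnum3 hd; rewrite /lexp; set h := (_ %/ _)%Z => h3.
set e := _ + _; move: hc; rewrite /alcove /=.
set al := 3 * a1 - 14; set be := 3 * a2 - 7 => hc.
(* By [hc] the subtracted term is below 4 * 63 = 84 * 3, whence 3 e > -3. *)
have X : 84 * (3 * e) = 3 * (14 * d.2 + 7 * d.1 + be) ^+ 2
    + (21 * d.1 + 2 * al - be) ^+ 2 - 4 * (al * al - al * be + be * be).
  have -> : 3 * e = 7 * (3 * h) + 3 * (a1 * d.1 + a2 * d.2) by rewrite /e; ring.
  by rewrite h3 /lnum /al /be; ring.
have := sqr_ge0 (14 * d.2 + 7 * d.1 + be).
have := sqr_ge0 (21 * d.1 + 2 * al - be); lia.
Qed.

Definition lterm (a1 a2 : int) (n : nat) (d : int * int) : fps int :=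
  lsign d * qz (lexp a1 a2 d) *
    (phi (Posz n + d.1) * phi (Posz n + d.2) * phi (Posz n - d.1 - d.2)).

(** Covers the support: n + d_j >= 0 for all j and d_1 + d_2 + d_3 = 0 force |d_j| <= 2n. *)
Definition box (n : nat) : seq (int * int) :=
  [seq (x, y) | x <- zrange (2 * n), y <- zrange (2 * n)].

Definition lat a1 a2 n : fps int := \sum_(d <- box n) lterm a1 a2 n d.

Lemma hsum_box n (F : int * int -> fps int) :
  (forall d, ~ [/\ 0 <= Posz n + d.1, 0 <= Posz n + d.2 & 0 <= Posz n - d.1 - d.2] ->
    F d = 0) -> hsum F (\sum_(d <- box n) F d).
Proof.
move=> h; apply: hsum_finite => [|[x y] hd].
  by apply: allpairs_uniq; rewrite ?zrange_uniq // => -[? ?] [? ?].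
apply: h => -[h1 h2 h3]; move/negP: hd; apply; apply: allpairs_f;
  by rewrite mem_zrange; move: h1 h2 h3 => /=; lia.
Qed.

Lemma hsum_lterm a1 a2 n : hsum (lterm a1 a2 n) (lat a1 a2 n).
Proof.
apply: hsum_box => d hd; rewrite /lterm.
case: (lerP 0 (Posz n + d.1)) => [h1|/phi_lt0->]; last by rewrite !mul0r mulr0.
case: (lerP 0 (Posz n + d.2)) => [h2|/phi_lt0->]; last by rewrite mulr0 mul0r mulr0.
case: (lerP 0 (Posz n - d.1 - d.2)) => [h3|/phi_lt0->]; last by rewrite !mulr0.
by case: hd.
Qed.

(* The rotation of x_1, x_2, x_3, which is the rotation of the profile. *)
Lemma lat_rot a1 a2 n : lat a1 a2 n = lat (7 - a2) (a1 - a2) n.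
Proof.
pose r (e : int * int) : int * int := (e.2, - e.1 - e.2).
pose r' (e : int * int) : int * int := (- e.1 - e.2, e.1).
apply: (hsum_unique (F := lterm (7 - a2) (a1 - a2) n)); last exact: hsum_lterm.
apply: (eq_hsum (F := lterm a1 a2 n \o r)); last first.
  apply: (@hsum_reindex _ _ _ _ r r' _ _ _ (hsum_lterm a1 a2 n)) => -[x y];
    by rewrite /r /r' /=; congr (_, _); ring.
move=> [x y]; rewrite /lterm /r /=.
have -> : lsign (y, - x - y) = lsign (x, y).
  by case: lsignP => k /= hk; case: lsignP => l /= hl //; lia.
have -> : lexp a1 a2 (y, - x - y) = lexp (7 - a2) (a1 - a2) (x, y).
  rewrite /lexp /=; have -> : lnum (y, - x - y) = x * 3 + lnum (x, y).
    by rewrite /lnum /=; ring.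
  by rewrite divzMDl //; ring.
have -> : Posz n + (- x - y) = Posz n - x - y by ring.
have -> : Posz n - y - (- x - y) = Posz n + x by ring.
by congr (_ * _); rewrite mulrC mulrA.
Qed.

Lemma hsum_antisym n (F : int * int -> fps int) (r : int * int -> int * int) :
  (forall d, ~ [/\ 0 <= Posz n + d.1, 0 <= Posz n + d.2 & 0 <= Posz n - d.1 - d.2] ->
    F d = 0) -> involutive r -> (forall d, F (r d) = - F d) -> hsum F 0.
Proof.
move=> /hsum_box hF; apply: hsum_odd => m.
by have [s [_ s0 _]] := hF m; exists s.
Qed.

(* Antisymmetry in x_1, x_2 on the wall a_1 = a_2 + 1, and in x_2, x_3 on the
   wall a_2 = 1. *)
Lemma hsum_wall12 a2 n (psi : int -> fps int) :
  (forall x : int, Posz n - x < 0 -> psi x = 0) ->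
  hsum (fun d => lsign d * qz (lexp (a2 + 1) a2 d + (Posz n + d.2)) *
    (phi (Posz n + d.1 - 1) * phi (Posz n + d.2) * psi (d.1 + d.2))) 0.
Proof.
(* In terms of x_j = d_j + j this exchanges x_1 and x_2. *)
move=> psi0; pose r (d : int * int) : int * int := (d.2 + 1, d.1 - 1).
apply: (@hsum_antisym n _ r).
- move=> d hd.
  case: (lerP 0 (Posz n + d.1)) => [h1|h1]; last first.
    by rewrite (@phi_lt0 (Posz n + d.1 - 1)) ?mul0r ?mulr0 //; lia.
  case: (lerP 0 (Posz n + d.2)) => [h2|/phi_lt0->]; last by rewrite mulr0 mul0r mulr0.
  case: (lerP 0 (Posz n - d.1 - d.2)) => [h3|h3]; first by case: hd.
  by rewrite psi0 ?mulr0 // opprD addrA.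
- by move=> [x y]; rewrite /r /=; congr (_, _); ring.
- move=> [x y]; rewrite /r /=.
  have -> : lsign (y + 1, x - 1) = - lsign (x, y).
    by case: lsignP => k /= hk; case: lsignP => l /= hl; rewrite ?opprK ?oppr0 //; lia.
  have -> : lexp (a2 + 1) a2 (y + 1, x - 1) + (Posz n + (x - 1)) =
      lexp (a2 + 1) a2 (x, y) + (Posz n + y).
    rewrite /lexp /=; have -> : lnum (y + 1, x - 1) = lnum (x, y).
      by rewrite /lnum /=; ring.
    by ring.
  have -> : Posz n + (y + 1) - 1 = Posz n + y by ring.
  have -> : y + 1 + (x - 1) = x + y by ring.
  have -> : Posz n + (x - 1) = Posz n + x - 1 by ring.
  by ring.
Qed.

Lemma hsum_wall23 a1 n (psi : int -> fps int) :
  (forall x : int, Posz n + x < 0 -> psi x = 0) ->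
  hsum (fun d => lsign d * qz (lexp a1 1 d + (Posz n - d.1 - d.2)) *
    (psi d.1 * phi (Posz n + d.2 - 1) * phi (Posz n - d.1 - d.2))) 0.
Proof.
(* With d_3 = -d_1 - d_2 this exchanges x_2 and x_3. *)
move=> psi0; pose r (d : int * int) : int * int := (d.1, 1 - d.1 - d.2).
apply: (@hsum_antisym n _ r).
- move=> d hd.
  case: (lerP 0 (Posz n + d.1)) => [h1|/psi0->]; last by rewrite !mul0r mulr0.
  case: (lerP 0 (Posz n + d.2)) => [h2|h2]; last first.
    by rewrite (@phi_lt0 (Posz n + d.2 - 1)) ?mulr0 ?mul0r ?mulr0 //; lia.
  case: (lerP 0 (Posz n - d.1 - d.2)) => [h3|/phi_lt0->]; last by rewrite !mulr0.
  by case: hd.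
- by move=> [x y]; rewrite /r /=; congr (_, _); ring.
- move=> [x y]; rewrite /r /=.
  have -> : lsign (x, 1 - x - y) = - lsign (x, y).
    by case: lsignP => k /= hk; case: lsignP => l /= hl; rewrite ?opprK ?oppr0 //; lia.
  have -> : Posz n - x - (1 - x - y) = Posz n + y - 1 by ring.
  have -> : Posz n + (1 - x - y) - 1 = Posz n - x - y by ring.
  have -> : lexp a1 1 (x, 1 - x - y) + (Posz n + y - 1) =
      lexp a1 1 (x, y) + (Posz n - x - y).
    rewrite /lexp /=; have -> : lnum (x, 1 - x - y) = lnum (x, y).
      by rewrite /lnum /=; ring.
    by ring.
  by ring.
Qed.

Lemma qz_lexp a1 a2 b1 b2 d k n x :
  alcove a1 a2 -> alcove b1 b2 -> lsign d != 0 -> 0 <= x ->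
  lexp b1 b2 d + Posz (k * n) = lexp a1 a2 d + x ->
  (q ^+ n) ^+ k * qz (lexp b1 b2 d) = qz (lexp a1 a2 d) * qz x.
Proof.
move=> ha hb hd x0 h; rewrite -exprM mulnC -qzn mulrC -!qzD ?h //; exact: lexp_ge0.
Qed.

(** A change of profile alters the exponent linearly in d, and the factor q^(m k) completes this to
    a sum [x] of k of the numbers m + d_j. All terms of the recurrence thereby share one exponent
    and one [phi] product. *)
Lemma expX_lterm a1 a2 b1 b2 d k m x :
  alcove a1 a2 -> alcove b1 b2 -> lsign d != 0 -> 0 <= x ->
  lexp b1 b2 d + Posz (k * m) = lexp a1 a2 d + x ->
  (q ^+ m) ^+ k * lterm b1 b2 m d = lsign d * (qz (lexp a1 a2 d) * qz x) *
    (phi (Posz m + d.1) * phi (Posz m + d.2) * phi (Posz m - d.1 - d.2)).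
Proof.
by move=> ha hb hd x0 h; rewrite -(qz_lexp ha hb hd x0 h) /lterm; ring.
Qed.

Lemma ltermS a1 a2 n d : lterm a1 a2 n d = lsign d * qz (lexp a1 a2 d) *
  (phi (Posz n.+1 + d.1 - 1) * phi (Posz n.+1 + d.2 - 1) * phi (Posz n.+1 - d.1 - d.2 - 1)).
Proof. by rewrite /lterm; congr (_ * (phi _ * phi _ * phi _)); lia. Qed.

(* Splits off the degenerate indices, at which every term is zero. *)
Ltac lat_generic m d s0 sd h1 h2 h3 :=
  have [s0|sd] := eqVneq (lsign d) 0; [by rewrite /lterm s0; ring |];
  case: (lerP 0 (Posz m + d.1)) => h1;
    [|by rewrite /lterm (phi_lt0 h1) (@phi_lt0 (Posz m + d.1 - 1)) //; [ring | lia]];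
  case: (lerP 0 (Posz m + d.2)) => h2;
    [|by rewrite /lterm (phi_lt0 h2) (@phi_lt0 (Posz m + d.2 - 1)) //; [ring | lia]];
  case: (lerP 0 (Posz m - d.1 - d.2)) => h3;
    [|by rewrite /lterm (phi_lt0 h3) (@phi_lt0 (Posz m - d.1 - d.2 - 1)) //; [ring | lia]].

(** Put X_j = q^(m + d_j). Up to a common factor the three wall terms are X_2 (1 - X_1), X_2 (1 -
    X_1)(1 - X_3) and X_3 (1 - X_1)(1 - X_2). They make up the difference between the recurrence, a
    product of some of the 1 - X_j, and the full product, which belongs to index n = m - 1. *)
Definition lwall12 a1 a2 m d := lsign d * qz (lexp a1 a2 d + (Posz m + d.2)) *
  (phi (Posz m + d.1 - 1) * phi (Posz m + d.2) * phi (Posz m - d.1 - d.2)).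
Definition lwall12' a1 a2 m d := lsign d * qz (lexp a1 a2 d + (Posz m + d.2)) *
  (phi (Posz m + d.1 - 1) * phi (Posz m + d.2) * phi (Posz m - d.1 - d.2 - 1)).
Definition lwall23 a1 a2 m d := lsign d * qz (lexp a1 a2 d + (Posz m - d.1 - d.2)) *
  (phi (Posz m + d.1 - 1) * phi (Posz m + d.2 - 1) * phi (Posz m - d.1 - d.2)).

Lemma lterm400 n d : let m := n.+1 in let t := q ^+ m in
  lterm 2 1 m d - t ^+ 1 * lterm 3 1 m d =
  lterm 2 1 n d + (lwall12 2 1 m d + lwall23 2 1 m d).
Proof.
move=> m t; rewrite (ltermS _ _ n) /lwall12 /lwall23 -/m.
lat_generic m d s0 sd h1 h2 h3.
have a : alcove 2 1 by [].
have e0 := lexp_ge0 a sd.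
rewrite (@expX_lterm 2 1 3 1 d 1 m ((Posz m + d.1)) a _ sd h1) //; last first.
  by rewrite /lexp; lia.
rewrite /lterm (qzD e0 h2) (qzD e0 h3) (phi_pred h1) (phi_pred h2) (phi_pred h3).
by ring.
Qed.

Lemma lterm310 n d : let m := n.+1 in let t := q ^+ m in
  lterm 3 1 m d - (t ^+ 1 * lterm 4 1 m d + t ^+ 1 * lterm 3 2 m d)
    + t ^+ 2 * lterm 4 2 m d = lterm 3 1 n d + lwall23 3 1 m d.
Proof.
move=> m t; rewrite (ltermS _ _ n) /lwall23 -/m.
lat_generic m d s0 sd h1 h2 h3.
have a : alcove 3 1 by [].
have e0 := lexp_ge0 a sd.
rewrite (@expX_lterm 3 1 4 1 d 1 m ((Posz m + d.1)) a _ sd h1) //; last first.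
  by rewrite /lexp; lia.
rewrite (@expX_lterm 3 1 3 2 d 1 m ((Posz m + d.2)) a _ sd h2) //; last first.
  by rewrite /lexp; lia.
rewrite (@expX_lterm 3 1 4 2 d 2 m ((Posz m + d.1) + (Posz m + d.2)) a _ sd (addr_ge0 h1 h2)) //; last first.
  by rewrite /lexp; lia.
rewrite /lterm (qzD h1 h2) (qzD e0 h3) (phi_pred h1) (phi_pred h2) (phi_pred h3).
by ring.
Qed.

Lemma lterm301 n d : let m := n.+1 in let t := q ^+ m in
  lterm 3 2 m d - (t ^+ 1 * lterm 4 2 m d + t ^+ 1 * lterm 2 1 m d)
    + t ^+ 2 * lterm 3 1 m d = lterm 3 2 n d + lwall12' 3 2 m d.
Proof.
move=> m t; rewrite (ltermS _ _ n) /lwall12' -/m.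
lat_generic m d s0 sd h1 h2 h3.
have a : alcove 3 2 by [].
have e0 := lexp_ge0 a sd.
rewrite (@expX_lterm 3 2 4 2 d 1 m ((Posz m + d.1)) a _ sd h1) //; last first.
  by rewrite /lexp; lia.
rewrite (@expX_lterm 3 2 2 1 d 1 m ((Posz m - d.1 - d.2)) a _ sd h3) //; last first.
  by rewrite /lexp; lia.
rewrite (@expX_lterm 3 2 3 1 d 2 m ((Posz m + d.1) + (Posz m - d.1 - d.2)) a _ sd (addr_ge0 h1 h3)) //; last first.
  by rewrite /lexp; lia.
rewrite /lterm (qzD h1 h3) (qzD e0 h2) (phi_pred h1) (phi_pred h2) (phi_pred h3).
by ring.
Qed.

Lemma lterm220 n d : let m := n.+1 in let t := q ^+ m in
  lterm 4 1 m d - (t ^+ 1 * lterm 5 1 m d + t ^+ 1 * lterm 4 2 m d)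
    + t ^+ 2 * lterm 5 2 m d = lterm 4 1 n d + lwall23 4 1 m d.
Proof.
move=> m t; rewrite (ltermS _ _ n) /lwall23 -/m.
lat_generic m d s0 sd h1 h2 h3.
have a : alcove 4 1 by [].
have e0 := lexp_ge0 a sd.
rewrite (@expX_lterm 4 1 5 1 d 1 m ((Posz m + d.1)) a _ sd h1) //; last first.
  by rewrite /lexp; lia.
rewrite (@expX_lterm 4 1 4 2 d 1 m ((Posz m + d.2)) a _ sd h2) //; last first.
  by rewrite /lexp; lia.
rewrite (@expX_lterm 4 1 5 2 d 2 m ((Posz m + d.1) + (Posz m + d.2)) a _ sd (addr_ge0 h1 h2)) //; last first.
  by rewrite /lexp; lia.
rewrite /lterm (qzD h1 h2) (qzD e0 h3) (phi_pred h1) (phi_pred h2) (phi_pred h3).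
by ring.
Qed.

(** All entries of the profile are positive, so all eight subsets J occur and give the full product
    of the 1 - q^(m + d_j); no wall term remains. *)
Lemma lterm211 n d : let m := n.+1 in let t := q ^+ m in
  lterm 4 2 m d - (t ^+ 1 * lterm 5 2 m d + t ^+ 1 * lterm 4 3 m d + t ^+ 1 * lterm 3 1 m d)
    + (t ^+ 2 * lterm 5 3 m d + t ^+ 2 * lterm 3 2 m d + t ^+ 2 * lterm 4 1 m d)
    - t ^+ 3 * lterm 4 2 m d = lterm 4 2 n d.
Proof.
move=> m t; rewrite (ltermS _ _ n) -/m.
lat_generic m d s0 sd h1 h2 h3.
have a : alcove 4 2 by [].
have e0 := lexp_ge0 a sd.
rewrite (@expX_lterm 4 2 5 2 d 1 m ((Posz m + d.1)) a _ sd h1) //; last first.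
  by rewrite /lexp; lia.
rewrite (@expX_lterm 4 2 4 3 d 1 m ((Posz m + d.2)) a _ sd h2) //; last first.
  by rewrite /lexp; lia.
rewrite (@expX_lterm 4 2 3 1 d 1 m ((Posz m - d.1 - d.2)) a _ sd h3) //; last first.
  by rewrite /lexp; lia.
rewrite (@expX_lterm 4 2 5 3 d 2 m ((Posz m + d.1) + (Posz m + d.2)) a _ sd (addr_ge0 h1 h2)) //; last first.
  by rewrite /lexp; lia.
rewrite (@expX_lterm 4 2 3 2 d 2 m ((Posz m + d.2) + (Posz m - d.1 - d.2)) a _ sd (addr_ge0 h2 h3)) //; last first.
  by rewrite /lexp; lia.
rewrite (@expX_lterm 4 2 4 1 d 2 m ((Posz m + d.1) + (Posz m - d.1 - d.2)) a _ sd (addr_ge0 h1 h3)) //; last first.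
  by rewrite /lexp; lia.
rewrite (@expX_lterm 4 2 4 2 d 3 m ((Posz m + d.1) + (Posz m + d.2) + (Posz m - d.1 - d.2)) a _ sd (addr_ge0 (addr_ge0 h1 h2) h3)) //; last first.
  by rewrite /lexp; lia.
rewrite /lterm (qzD (addr_ge0 h1 h2) h3) (qzD h1 h2) (qzD h1 h3) (qzD h2 h3) (phi_pred h1) (phi_pred h2) (phi_pred h3).
by ring.
Qed.

Lemma hsum_lwall12 m : hsum (lwall12 2 1 m) 0.
Proof.
apply: eq_hsum (@hsum_wall12 1 m (fun x => phi (Posz m - x)) _) => [d|x /phi_lt0//].
by rewrite /lwall12 -[Posz m - _ - _]addrA -opprD.
Qed.

Lemma hsum_lwall12' m : hsum (lwall12' 3 2 m) 0.
Proof.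
apply: eq_hsum (@hsum_wall12 2 m (fun x => phi (Posz m - x - 1)) _) => [d|x h].
  by rewrite /lwall12' -[Posz m - _ - d.2]addrA -opprD.
by apply: phi_lt0; lia.
Qed.

Lemma hsum_lwall23 a1 m : hsum (lwall23 a1 1 m) 0.
Proof.
apply: eq_hsum (@hsum_wall23 a1 m (fun x => phi (Posz m + x - 1)) _) => [d|x h] //.
by apply: phi_lt0; lia.
Qed.

Lemma lat_rec : cyl_rec (lat 2 1) (lat 3 1) (lat 3 2) (lat 4 1) (lat 4 2).
Proof.
move=> n t m.
(* The termwise recurrences also involve rotated profiles, which are brought back to the chosen
   representatives. *)
have r51 : lat 3 2 m = lat 5 1 m by rewrite [RHS]lat_rot [RHS]lat_rot.
have r52 : lat 4 2 m = lat 5 2 m by rewrite [RHS]lat_rot [RHS]lat_rot.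
have r43 : lat 4 1 m = lat 4 3 m by rewrite [RHS]lat_rot.
have r53 : lat 4 2 m = lat 5 3 m by rewrite [RHS]lat_rot.
have hl a1 a2 k : hsum (fun d => t ^+ k * lterm a1 a2 m d) (t ^+ k * lat a1 a2 m).
  exact: hsumMl (hsum_lterm _ _ _).
have h0 a1 a2 := hsum_lterm a1 a2 n.
have hm a1 a2 := hsum_lterm a1 a2 m.
have eqn (x y : fps int) (F G W : int * int -> fps int) : hsum F x -> hsum G y ->
    hsum W 0 -> (forall d, F d = G d + W d) -> y = x.
  move=> hF hG hW e; rewrite -[y]addr0; apply: hsum_unique (hsumD hG hW) _.
  exact: eq_hsum hF.
have w0 : hsum (fun _ : int * int => 0 : fps int) 0.
  by move=> k; exists [::]; split=> //; rewrite big_nil.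
split.
- rewrite -[t]expr1.
  apply: (eqn _ _ _ _ _ (hsumB (hm 2 1) (hl 3 1 1%N)) (h0 2 1) _ (lterm400 n)).
  by have := hsumD (hsum_lwall12 m) (hsum_lwall23 2 m); rewrite addr0.
- rewrite mulrDr -[t in t * _]expr1.
  exact: eqn _ _ _ _ _ (hsumD (hsumB (hm 3 1) (hsumD (hl 4 1 1%N) (hl 3 2 1%N))) (hl 4 2 2%N))
    (h0 3 1) (hsum_lwall23 3 m) (lterm310 n).
- rewrite mulrDr -[t in t * _]expr1.
  exact: eqn _ _ _ _ _ (hsumD (hsumB (hm 3 2) (hsumD (hl 4 2 1%N) (hl 2 1 1%N))) (hl 3 1 2%N))
    (h0 3 2) (hsum_lwall12' m) (lterm301 n).
- rewrite mulrDr -[t in t * _]expr1 r51 {2}r52.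
  exact: eqn _ _ _ _ _ (hsumD (hsumB (hm 4 1) (hsumD (hl 5 1 1%N) (hl 4 2 1%N))) (hl 5 2 2%N))
    (h0 4 1) (hsum_lwall23 4 m) (lterm220 n).
- rewrite !mulrDr -[t in t * _]expr1 {2}r52 {1}r43 {2}r53.
  apply: eqn _ _ _ _ _ (hsumB (hsumD (hsumB (hm 4 2)
      (hsumD (hsumD (hl 5 2 1%N) (hl 4 3 1%N)) (hl 3 1 1%N)))
      (hsumD (hsumD (hl 5 3 2%N) (hl 3 2 2%N)) (hl 4 1 2%N))) (hl 4 2 3%N))
    (h0 4 2) w0 _ => d.
  by rewrite addr0; apply: lterm211.
Qed.

Lemma lat0 a1 a2 : lat a1 a2 0 = 1.
Proof.
rewrite /lat big_allpairs /zrange !big_map /index_iota /= !big_cons !big_nil !addr0.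
by rewrite /lterm /lsign /= /qz /lexp /= !mulr0 /= qpoch0 invr1 !mulr1.
Qed.

Lemma cylH0 F : cylH F 0 = fcoef F 0.
Proof. by rewrite /cylH fcoef0M /= qpoch0 invr1 mulr1. Qed.

Lemma dsum_coef00 a b : dsum_coef 0 a b 0 = 1.
Proof. by rewrite /dsum_coef big_nat1 /qexp qpoch0 gauss0 // !muln0 divr1 mulr1. Qed.

Lemma cylH_lat n :
  [/\ cylH cylG400 n = lat 2 1 n, cylH cylG310 n = lat 3 1 n,
      cylH cylG301 n = lat 3 2 n, cylH cylG220 n = lat 4 1 n
    & cylH cylG211 n = lat 4 2 n].
Proof.
apply: (cyl_rec_unique cylH_rec lat_rec); rewrite !lat0 !cylH0.
have c F G : fcoef (F + qc ^+ 1 * z * G) 0 = fcoef F 0.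
  by rewrite fcoefD -mulrA fcoef_qcM fcoef_zM mulr0 addr0.
by split; rewrite ?c; apply: dsum_coef00.
Qed.

(** * The Macdonald identity for the affine root system A_2 *)

Lemma qpoch_dissect (R : comUnitRingType) (Q : fps R) b n :
  \prod_(0 <= i < b) qpoch (Q ^+ i.+1) (Q ^+ b) n = qpoch Q Q (b * n).
Proof.
elim: n => [|n IHn].
  by rewrite muln0 qpoch0 big1 // => i _; rewrite qpoch0.
under eq_bigr do rewrite qpochS.
rewrite big_split /= IHn mulnS addnC.
have -> : qpoch Q Q (b * n + b) =
    qpoch Q Q (b * n) * \prod_(0 + b * n <= j < b * n + b) (1 - Q * Q ^+ j).
  by rewrite /qpoch (@big_cat_nat _ _ _ (b * n)) ?leq_addr.
congr (_ * _); rewrite big_addn addKn.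
by apply: eq_bigr => i _; rewrite -exprM -exprD -exprS addSn.
Qed.

(** The exponents are sorted modulo b, and the finite form is taken to the limit along the indices b
    n. *)
Lemma qpoch_inf_dissect b : (0 < b)%N -> forall k, (0 < k)%N ->
  \prod_(0 <= i < b) qpoch_inf (q ^+ (k * i.+1)) (q ^+ (k * b)) =
  qpoch_inf (q ^+ k) (q ^+ k).
Proof.
move=> b_gt0 k k_gt0; set Q := q ^+ k; rewrite exprM.
under eq_bigr do rewrite exprM.
rewrite -/Q.
have Q0 : fcoef Q 0 = 0 by apply: fcoef0X.
have Qb0 : fcoef (Q ^+ b) 0 = 0 by rewrite -exprM fcoef0X // muln_gt0 k_gt0.
have h : fps_cvg (fun n => qpoch Q Q (b * n)) (qpoch_inf Q Q).
  apply: (fps_cvg_sub (s := fun n => (b * n)%N)); last exact: qpoch_inf_cvg.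
  by move=> n; rewrite leq_pmull.
apply: fps_cvg_unique h.
suff h (s : seq nat) : fps_cvg (fun n => \prod_(i <- s) qpoch (Q ^+ i.+1) (Q ^+ b) n)
    (\prod_(i <- s) qpoch_inf (Q ^+ i.+1) (Q ^+ b)).
  move=> n; have [N hN] := h (index_iota 0 b) n; exists N => m /hN <-.
  by rewrite qpoch_dissect.
elim: s => [|i s IHs].
  by rewrite big_nil => n; exists 0%N => m _; rewrite big_nil.
move=> n; have [N hN] := fps_cvgM (qpoch_inf_cvg (Q ^+ i.+1) Qb0) IHs n.
by exists N => m /hN; rewrite !big_cons.
Qed.

Definition jprod (i : nat) : fps int :=
  qpoch_inf (q ^+ i) (q ^+ 7) * qpoch_inf (q ^+ (7 - i)) (q ^+ 7)
    * qpoch_inf (q ^+ 7) (q ^+ 7).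

(** Euler's theorem in q^7: for b = 21 and i = 7 the triple product (q^7, q^14, q^21; q^21)_oo
    collapses to (q^7;q^7)_oo. *)
Lemma hsum_pentagonal : hsum (fun j => zsign j * qz (jexp 21 7 j))
  (qpoch_inf (q ^+ 7) (q ^+ 7)).
Proof.
have prod3 (f : nat -> fps int) : \prod_(0 <= i < 3) f i = f 0%N * f 1%N * f 2%N.
  by rewrite !big_nat_recl // big_nil mulr1 mulrA.
have e := etrans (esym (prod3 _)) (@qpoch_inf_dissect 3 erefl 7 erefl).
have h := @jacobi_triple 21 7 erefl erefl.
exact: (eq_ind _ _ h _ e).
Qed.

Lemma zsign2 k : zsign (2 * k) = 1.
Proof. by rewrite mulr_natl mulr2n zsignD /zsign -exprD addnn -mul2n exprM sqrrN !expr1n. Qed.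

Lemma zsign_odd k u : zsign (2 * k + (1 + u)) = - zsign u.
Proof. by rewrite !zsignD zsign2 mul1r [zsign 1]expr1 mulN1r. Qed.

(** For fixed d the exponent of the triple product is, as a function of n, a pentagonal exponent
    centred at k plus the exponent of the lattice sum. *)
Lemma triple_exp_pos (x y k n h c1 c2 : int) :
  2 * x + y = 3 * k -> 3 * h = lnum (x, y) ->
  7 * h + c1 + c2 + jexp 21 7 (-1 * (n - k)) =
  7 * (tri (x - n) + tri (x + y - n) + tri n) + c1 + c2.
Proof.
move=> hk; have -> : y = 3 * k - 2 * x by lia.
rewrite /lnum /jexp /=.
have := tri_eq (x - n); have := tri_eq (x + (3 * k - 2 * x) - n).
by have := tri_eq n; have := tri_eq (-1 * (n - k)); lia.
Qed.

Lemma triple_exp_neg (x y k n h c1 c2 : int) :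
  2 * x + y = 3 * k + 1 -> 3 * h = lnum (x, y) ->
  7 * h + c1 + c2 + jexp 21 7 (1 * (n - k)) =
  7 * (tri (x - n) + tri (x + y - n) + tri n) + c1 + c2.
Proof.
move=> hk; have -> : y = 3 * k + 1 - 2 * x by lia.
rewrite /lnum /jexp /=.
have := tri_eq (x - n); have := tri_eq (x + (3 * k + 1 - 2 * x) - n).
by have := tri_eq n; have := tri_eq (1 * (n - k)); lia.
Qed.

Lemma triple_exp_zero (x y k n : int) : 2 * x + y = 3 * k + 2 ->
  let n' := 2 * k + 1 - n in
  tri (x - n') + tri (x + y - n') + tri n' = tri (x - n) + tri (x + y - n) + tri n.
Proof.
move=> hk; have -> : y = 3 * k + 2 - 2 * x by lia.
move=> /=; have := tri_eq (x - n); have := tri_eq (x + (3 * k + 2 - 2 * x) - n).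
have := tri_eq n; have := tri_eq (2 * k + 1 - n).
have := tri_eq (x - (2 * k + 1 - n)).
by have := tri_eq (x + (3 * k + 2 - 2 * x) - (2 * k + 1 - n)); lia.
Qed.

Section Macdonald.
Variables a1 a2 : nat.
Hypothesis a2_gt0 : (0 < a2)%N.
Hypothesis lt_a2a1 : (a2 < a1)%N.
Hypothesis lt_a1 : (a1 < 7)%N.
Hypothesis alc : alcove a1 a2.

Let i1 := (a1 - a2)%N.
Let i1_gt0 : (0 < i1)%N. Proof. by rewrite subn_gt0. Qed.
Let lt_i1 : (i1 < 7)%N. Proof. exact: leq_ltn_trans (leq_subr _ _) lt_a1. Qed.
Let lt_a2 : (a2 < 7)%N. Proof. exact: ltn_trans lt_a1. Qed.
Let a1_gt0 : (0 < a1)%N. Proof. exact: ltn_trans lt_a2a1. Qed.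

Let triple (d : int * int) (n : int) : fps int :=
  zsign (2 * d.1 + d.2 - n) *
  qz (7 * (tri (d.1 - n) + tri (d.1 + d.2 - n) + tri n)
      + Posz a1 * d.1 + Posz a2 * d.2).

(** The indices (l, m, n) of the three theta series are replaced by d = (l + n, m - l) and n, a
    unimodular change of variables. *)
Lemma hsum_triple :
  hsum (fun x => triple x.1 x.2) (jprod i1 * (jprod a2 * jprod a1)).
Proof.
have h := hsumM (jacobi_triple i1_gt0 lt_i1)
  (hsumM (jacobi_triple a2_gt0 lt_a2) (jacobi_triple a1_gt0 lt_a1)).
pose f (x : (int * int) * int) : int * (int * int) :=
  (x.1.1 - x.2, (x.1.1 + x.1.2 - x.2, x.2)).
pose g (y : int * (int * int)) : (int * int) * int :=
  ((y.1 + y.2.2, y.2.1 - y.1), y.2.2).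
have fK : cancel f g.
  by move=> [[x y] n]; rewrite /f /g /=; congr ((_, _), _); ring.
have gK : cancel g f.
  by move=> [l [m n]]; rewrite /f /g /=; congr (_, (_, _)); ring.
apply: eq_hsum (hsum_reindex fK gK h) => -[[x y] n]; rewrite /f /triple /=.
have := jexp_ge i1_gt0 lt_i1 (x - n); have := jexp_ge a2_gt0 lt_a2 (x + y - n).
have := jexp_ge a1_gt0 lt_a1 n; set e1 := jexp _ _ _; set e2 := jexp _ _ _.
set e3 := jexp _ _ _ => h1 h2 h3.
have -> : 2 * x + y - n = (x - n) + ((x + y - n) + n) by ring.
have -> : 7 * (tri (x - n) + tri (x + y - n) + tri n) + Posz a1 * x + Posz a2 * y =
    e3 + (e2 + e1).
  rewrite /e1 /e2 /e3 /jexp /i1 -subzn ?(ltnW lt_a2a1) //; ring.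
have p1 := le_trans (normr_ge0 _) h1; have p2 := le_trans (normr_ge0 _) h2.
have p3 := le_trans (normr_ge0 _) h3.
by rewrite !zsignD (qzD p3 (addr_ge0 p2 p1)) (qzD p2 p1); ring.
Qed.

(** The residue of 2 d_1 + d_2 modulo 3 decides: 0 and 1 give a recentred pentagonal series with
    sign 1 and -1, while 2 gives a family odd under n -> 2k + 1 - n. *)
Lemma hsum_triple_inner d : hsum (triple d)
  (lsign d * qz (lexp a1 a2 d) * qpoch_inf (q ^+ 7) (q ^+ 7)).
Proof.
have jge := @jexp_ge 21 7 erefl erefl.
have pent k (s : int) : s = 1 \/ s = -1 ->
    hsum (fun n => zsign (s * (n - k)) * qz (jexp 21 7 (s * (n - k))))
      (qpoch_inf (q ^+ 7) (q ^+ 7)).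
  move=> hs.
  pose f (n : int) := s * (n - k); pose g (j : int) := s * j + k.
  have ss : s * s = 1 by case: hs => ->.
  apply: (hsum_reindex (a := f) (b := g) _ _ hsum_pentagonal) => x; rewrite /f /g.
    by rewrite mulrA ss mul1r subrK.
  by rewrite addrK mulrA ss mul1r.
have := @lnum3 d; have := @lexp_ge0 _ _ d alc; rewrite /lexp.
have [k hk|k hk|k hk] := lsignP d.
- move=> /(_ (oner_neq0 _)) l0 /(_ (oner_neq0 _)) l3; rewrite mul1r.
  apply: eq_hsum (hsumMl _ (pent k (-1) _)) => [n|]; last by right.
  rewrite /triple hk.
  have -> : 3 * k - n = 2 * k + (-1 * (n - k)) by ring.
  have j0 := le_trans (normr_ge0 _) (jge (-1 * (n - k))).
  rewrite zsignD zsign2 mul1r mulrCA -(qzD l0 j0).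
  by congr (_ * qz _); apply: triple_exp_pos => //; case: (d) l3.
- have N1 : (-1 : fps int) != 0 by rewrite oppr_eq0 oner_neq0.
  move=> /(_ N1) l0 /(_ N1) l3.
  apply: eq_hsum (hsumMl _ (pent k 1 _)) => [n|]; last by left.
  rewrite /triple hk.
  have -> : 3 * k + 1 - n = 2 * (2 * k - n) + (1 + 1 * (n - k)) by ring.
  have j0 := le_trans (normr_ge0 _) (jge (1 * (n - k))).
  rewrite zsign_odd mulN1r !mulNr mulrCA -(qzD l0 j0); congr (- _).
  by congr (_ * qz _); apply: triple_exp_neg => //; case: (d) l3.
- move=> _ _; rewrite !mul0r.
  apply: (@hsum_odd _ _ (fun n => 2 * k + 1 - n)).
  + move=> m; have [s [_ s0 _]] := hsum_triple m; exists (map snd s) => n hn.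
    by apply: (s0 (d, n)); apply: contra hn => hn; apply/mapP; exists (d, n).
  + by move=> n; ring.
  + move=> n; rewrite /triple hk.
    have -> : 3 * k + 2 - (2 * k + 1 - n) = 2 * (n - k - 1) + (1 + (3 * k + 2 - n)) by ring.
    rewrite zsign_odd mulNr.
    by congr (- (_ * qz (7 * _ + _ + _))); apply: triple_exp_zero.
Qed.

Lemma macdonald : hsum (fun d => lsign d * qz (lexp a1 a2 d))
  (jprod i1 * (jprod a2 * jprod a1) / qpoch_inf (q ^+ 7) (q ^+ 7)).
Proof.
have U : qpoch_inf (q ^+ 7) (q ^+ 7) \is a GRing.unit by [].
have h := hsum_sigma (F := fun x => triple x.1 x.2) hsum_triple hsum_triple_inner.
by apply: eq_hsum (hsumMr _ h) => d; rewrite mulrK.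
Qed.

End Macdonald.

(** * The limit of the recurrence *)

Lemma phi_cvg (x : int) :
  fps_cvg (fun n => phi (Posz n + x)) (qpoch_inf q q)^-1.
Proof.
have cV : fps_cvg (fun n => (qpoch q q n)^-1) (qpoch_inf q q)^-1.
  by apply: fps_cvgV => //; apply: qpoch_inf_cvg.
move=> k; have [N hN] := cV k; exists (N + `|x|)%N => n le_n.
have [m le_m ->] : exists2 m : nat, (N <= m)%N & Posz n + x = Posz m.
  by exists `|(Posz n + x)%R|%N; lia.
exact: hN.
Qed.

(** The support list of the limiting series dominates for every n, as each [lterm] only has
    additional factors; the three [phi] tend to 1/(q;q)_oo each. *)
Lemma lat_cvg a1 a2 f : hsum (fun d => lsign d * qz (lexp a1 a2 d)) f ->
  fps_cvg (lat a1 a2) (f * (qpoch_inf q q)^-1 ^+ 3).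
Proof.
move=> hf; apply: (dominated_cvg (F := fun n d => lterm a1 a2 n d)
  (G := fun d => lsign d * qz (lexp a1 a2 d) * (qpoch_inf q q)^-1 ^+ 3)).
- move=> m; have [s [_ s0 _]] := hf m; exists s => d /s0 h n.
  exact: eqmM0l.
- by move=> n; apply: hsum_lterm.
- move=> d; apply: fps_cvgM; first exact: fps_cvg_const.
  rewrite exprSr expr2; apply: fps_cvgM; first apply: fps_cvgM.
  + exact: phi_cvg.
  + exact: phi_cvg.
  + move=> k; have [N hN] := phi_cvg (- d.1 - d.2) k.
    by exists N => n /hN; rewrite addrA.
- exact: hsumMr.
Qed.

(** An Abel-type limit: the coefficient of z^n in F(z)/(z;q)_oo tends to F(1)/(q;q)_oo. *)
Lemma cylH_cvg F f : hsum (fcoef F) f ->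
  fps_cvg (cylH F) (f * (qpoch_inf q q)^-1).
Proof.
move=> hf; apply: (dominated_cvg (F := fun n r => fcoef F r * phi (Posz n - Posz r))
  (G := fun r => fcoef F r * (qpoch_inf q q)^-1)).
- move=> m; have [s [_ s0 _]] := hf m; exists s => d /s0 h n.
  exact: eqmM0l.
- move=> n; have -> : cylH F n =
      \sum_(r <- index_iota 0 n.+1) fcoef F r * phi (Posz n - Posz r).
    rewrite /cylH fcoefM big_mkord; apply: eq_bigr => i _ /=.
    by rewrite subzn // -ltnS.
  apply: hsum_finite; first exact: iota_uniq.
  move=> r; rewrite mem_index_iota /= -leqNgt => lt_nr.
  by rewrite phi_lt0 ?mulr0 //; lia.
- move=> r; apply: fps_cvgM; first exact: fps_cvg_const.
  exact: phi_cvg.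
- exact: hsumMr.
Qed.

Lemma mulr_clear_denominators (R : comUnitRingType) (f g x y : R) :
  x \is a GRing.unit -> y \is a GRing.unit ->
  f / x = g / y * x^-1 ^+ 3 -> f * (x ^+ 2 * y) = g.
Proof.
move=> xU yU e; have -> : f * (x ^+ 2 * y) = f / x * (x ^+ 3 * y).
  by rewrite (exprS x 2) !mulrA mulrVK.
by rewrite e exprVn mulrA mulrVK ?unitrX // mulrVK.
Qed.

(** One sequence has the limits f/(q;q)_oo and (theta series)/(q;q)_oo^3; these are equated and
    denominators cleared. *)
Lemma cyl_product F (a1 a2 : nat) f :
  (0 < a2)%N -> (a2 < a1)%N -> (a1 < 7)%N -> alcove a1 a2 ->
  (forall n, cylH F n = lat a1 a2 n) -> hsum (fcoef F) f ->
  f * (qpoch_inf q q ^+ 2 * qpoch_inf (q ^+ 7) (q ^+ 7)) =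
  jprod (a1 - a2) * (jprod a2 * jprod a1).
Proof.
move=> h1 h2 h3 h4 hF /cylH_cvg cF.
have cL := lat_cvg (macdonald h1 h2 h3 h4).
apply: mulr_clear_denominators => //; apply: fps_cvg_unique cL => k.
by have [N hN] := cF k; exists N => n /hN <-; rewrite hF.
Qed.

(** * Evaluation at z = 1 *)

Definition dval m a b : fps int := nat_sum (dsum_coef m a b).

Lemma hsum_dval m a b : hsum (fcoef (dsum m a b)) (dval m a b).
Proof.
apply: hsum_nat => n; apply: eqm_sum0 => s _; rewrite -mulrA; apply: eqm_X.
(* The exponent is at least n: it contains n^2 if s = 0, and (n - s)^2 + n s if s > 0. *)
have := qexpE a b n s; case: s => [|s]; first by nia.
by have := sqr_ge0 (Posz n - Posz s.+1); nia.
Qed.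

Lemma hsum_qcM k F f : hsum (fcoef F) f -> hsum (fcoef (qc ^+ k * F)) (q ^+ k * f).
Proof. by move/(hsumMl (q ^+ k)); apply: eq_hsum => n; rewrite fcoef_qcM. Qed.

Lemma hsum_zM F f : hsum (fcoef F) f -> hsum (fcoef (z * F)) f.
Proof. by move/hsum_shift; apply: eq_hsum => n; rewrite fcoef_zM. Qed.

Lemma dval_pascal m a b :
  dval m.+1 a.+1 b = dval m a.+1 b.+1 + q ^+ b.+1 * dval m a b.+2.
Proof.
apply: hsum_unique (hsum_dval _ _ _) _; rewrite dsum_pascal.
by apply: hsumD; [|apply: hsum_qcM]; apply: hsum_dval.
Qed.

Lemma dval_pascal' m a b :
  dval m.+1 a b = dval m a b + q ^+ (m.+1 + b) * dval m a.+1 b.+1.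
Proof.
apply: hsum_unique (hsum_dval _ _ _) _; rewrite dsum_pascal'.
by apply: hsumD; [|apply: hsum_qcM]; apply: hsum_dval.
Qed.

Lemma dval_outer m a b :
  dval m a b.+1 = dval m a.+1 b.+1 + q ^+ a.+1 * dval m.+2 a.+2 b.
Proof.
apply: hsum_unique (hsum_dval _ _ _) _; rewrite dsum_outer.
by apply: hsumD; [|apply: hsum_zM; apply: hsum_qcM]; apply: hsum_dval.
Qed.

Lemma dval_inner a b : dval 0 a b = dval 0 a b.+1 +
  q ^+ (1 + a + b) * (dval 1 a.+1 b.+1 + q ^+ 1 * dval 1 a.+2 b.+1).
Proof.
apply: hsum_unique (hsum_dval _ _ _) _; rewrite dsum_inner.
apply: hsumD; [|apply: hsum_zM; apply: hsum_qcM; apply: hsumD; [|apply: hsum_qcM]];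
  exact: hsum_dval.
Qed.

(** Combines all four relations at z = 1, where terms that carried z cancel against terms that did
    not. *)
Lemma dval_gap c : dval 0 c.+1 c.+2 - dval 1 c.+2 c.+1 =
  q ^+ (2 * c + 4) * (dval 0 c.+2 c.+3 - dval 1 c.+3 c.+2).
Proof.
(* The two Pascal expansions of [dval 1 c.+1 c] are equated, and [dval_inner] removes the common
   part. *)
have e1 : q ^+ c.+1 * (dval 0 c c.+2 - dval 0 c.+2 c.+1) =
    q ^+ c.+1 * (q ^+ c.+1 * (dval 1 c.+2 c.+1 + q * dval 1 c.+3 c.+1)).
  have h1 := dval_pascal 0 c c; have h2 := dval_pascal' 0 c.+1 c.
  have h3 := dval_inner c.+1 c; move: h1 h2; rewrite h3 => -> h.
  have -> : q ^+ c.+1 * (q ^+ c.+1 * (dval 1 c.+2 c.+1 + q * dval 1 c.+3 c.+1)) =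
     q ^+ (1 + c.+1 + c) * (dval 1 c.+2 c.+1 + q ^+ 1 * dval 1 c.+3 c.+1).
    by rewrite mulrA -exprD expr1; congr (q ^+ _ * _); lia.
  rewrite mulrBr; apply/eqP; rewrite subr_eq; apply/eqP.
  by apply: (addrI (dval 0 c.+1 c.+1)); rewrite h addrA.
move/fpsXn_inj: e1; rewrite (dval_outer 0 c c.+1) (dval_pascal' 1) => e2.
have e3 := dval_pascal 0 c.+2 c.+1; have e4 := dval_pascal' 0 c.+2 c.+1.
have -> : dval 0 c.+1 c.+2 = dval 0 c.+2 c.+1 +
    q ^+ c.+2 * (dval 1 c.+3 c.+1 - q ^+ c.+2 * dval 1 c.+3 c.+2).
  apply/eqP; rewrite -subr_eq0; apply/eqP.
  move/eqP: e2; rewrite -subr_eq0 => /eqP <-.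
  have -> : (2 + c.+1 = c.+1.+2)%N by [].
  by rewrite !exprS; ring.
rewrite e4 e3 add1n.
have -> : q ^+ (2 * c + 4) = q ^+ c.+2 * q ^+ c.+2.
  by rewrite -exprD; congr (_ ^+ _); lia.
by ring.
Qed.

(* By dval_gap, the difference of the two sides is divisible by arbitrarily high
   powers of q. *)
Lemma dval_gap0 c : dval 0 c.+1 c.+2 = dval 1 c.+2 c.+1.
Proof.
apply/eqP; rewrite -subr_eq0; apply/eqP; apply: eqm_eq => m.
elim: m c => [|m IHm] c //; rewrite dval_gap.
apply: (@eqmW _ _ (2 * c + 4 + m)); first by lia.
by rewrite -[0](mulr0 (q ^+ (2 * c + 4))); apply: eqmX.
Qed.

(** Identifies the fourth sum of the theorem with [cylG220] at z = 1; the case c = 0 of [dval_gap0]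
    closes the gap. *)
Lemma dval_220 : dval 1 0 1 = dval 0 1 0 + q ^+ 1 * dval 1 2 0.
Proof.
rewrite (dval_pascal' 0 0 1) (dval_outer 0 0 0) (dval_pascal' 1 2 0) (dval_inner 1 0).
by rewrite dval_gap0; ring.
Qed.

(** At z = 1 the two summands of [cylG301] recombine by Pascal's rule. *)
Lemma hsum_cylG301 : hsum (fcoef cylG301) (dval 1 1 0).
Proof.
rewrite (dval_pascal' 0 1 0) /cylG301 -mulrA; apply: hsumD; first exact: hsum_dval.
by apply: hsum_qcM; apply: hsum_zM; apply: hsum_dval.
Qed.

Lemma hsum_cylG220 : hsum (fcoef cylG220) (dval 1 0 1).
Proof.
rewrite dval_220 /cylG220 -mulrA; apply: hsumD; first exact: hsum_dval.
by apply: hsum_qcM; apply: hsum_zM; apply: hsum_dval.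
Qed.

Lemma dval_has_sum m a b (u : nat -> fps int) f :
  dval m a b = f -> (forall n, u n = dsum_coef m a b n) -> fps_has_sum u f.
Proof.
move=> <- e; apply: hsum_has_sum; apply: eq_hsum (hsum_dval m a b) => n.
by rewrite e.
Qed.

(** * The product sides *)

Section ProductSides.
Variables (R : comUnitRingType) (x1 x2 x3 x4 x5 x6 x7 p f : R).
Hypothesis pE : x1 * (x2 * (x3 * (x4 * (x5 * (x6 * x7))))) = p.
Hypothesis pU : p \is a GRing.unit.
Hypothesis x7U : x7 \is a GRing.unit.

(** Each x_i stands for (q^i;q^7)_oo and [p] for (q;q)_oo, so that theta_i is [jprod i]. *)
Let theta1 := x1 * x6 * x7.
Let theta2 := x2 * x5 * x7.
Let theta3 := x3 * x4 * x7.

(** [X] collects the factors of p^2 x7 left over by the theta product [J]; it is a unit because f X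
    = 1. *)
Lemma eq_inv_prod J X :
  f * (p ^+ 2 * x7) = J -> J * X = p ^+ 2 * x7 -> f = 1 / X.
Proof.
move=> fJ JX; have U : p ^+ 2 * x7 \is a GRing.unit by rewrite unitrM unitrX.
have fX : f * X = 1.
  by apply: (mulIr U); rewrite mul1r mulrAC fJ JX.
have XU : X \is a GRing.unit by apply/unitrPr; exists f; rewrite mulrC.
by apply: (mulIr XU); rewrite fX div1r mulVr.
Qed.

Lemma product400 : f * (p ^+ 2 * x7) = theta1 * (theta1 * theta2) ->
  f = 1 / (x2 * (x3 * (x3 * (x4 * (x4 * x5))))).
Proof. by move/eq_inv_prod; apply; rewrite -pE /theta1 /theta2; ring. Qed.

Lemma product310 : f * (p ^+ 2 * x7) = theta2 * (theta1 * theta3) ->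
  f = 1 / (x1 * (x2 * (x3 * (x4 * (x5 * x6))))).
Proof. by move/eq_inv_prod; apply; rewrite -pE /theta1 /theta2 /theta3; ring. Qed.

Lemma product301 : f * (p ^+ 2 * x7) = theta1 * (theta2 * theta3) ->
  f = 1 / (x1 * (x2 * (x3 * (x4 * (x5 * x6))))).
Proof. by move/eq_inv_prod; apply; rewrite -pE /theta1 /theta2 /theta3; ring. Qed.

(** The factor x4 x3 x7 is [jprod 4], that is [theta3] with two factors exchanged. *)
Lemma product220 :
  f * (p ^+ 2 * x7) = theta3 * (theta1 * (x4 * x3 * x7)) ->
  f = 1 / (x1 * (x2 * (x2 * (x5 * (x5 * x6))))).
Proof. by move/eq_inv_prod; apply; rewrite -pE /theta1 /theta3; ring. Qed.

Lemma product211 :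
  f * (p ^+ 2 * x7) = theta2 * (theta2 * (x4 * x3 * x7)) ->
  f = 1 / (x1 * (x1 * (x3 * (x4 * (x6 * x6))))).
Proof. by move/eq_inv_prod; apply; rewrite -pE /theta2; ring. Qed.

End ProductSides.

Lemma qpochs_inf6 (R : comUnitRingType) (a b c d e f Q : fps R) :
  qpochs_inf [:: a; b; c; d; e; f] Q =
  qpoch_inf a Q * (qpoch_inf b Q * (qpoch_inf c Q *
    (qpoch_inf d Q * (qpoch_inf e Q * qpoch_inf f Q)))).
Proof. by rewrite /qpochs_inf !big_cons big_nil mulr1. Qed.

Definition qpoch7 i : fps int := qpoch_inf (q ^+ i) (q ^+ 7).

Lemma qpoch_inf_dissect7 :
  qpoch7 1 * (qpoch7 2 * (qpoch7 3 * (qpoch7 4 * (qpoch7 5 * (qpoch7 6 * qpoch7 7))))) = qpoch_inf q q.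
Proof.
have prod7 (f : nat -> fps int) : \prod_(0 <= i < 7) f i =
    f 0%N * (f 1%N * (f 2%N * (f 3%N * (f 4%N * (f 5%N * f 6%N))))).
  by rewrite !big_nat_recl // big_nil mulr1.
exact: etrans (esym (prod7 _)) (@qpoch_inf_dissect 7 erefl 1 erefl).
Qed.

Theorem theorem1p1 : let q : fps int := fpsX in
  [/\ fps_has_sum (fun n1 => \sum_(0 <= n2 < (2 * n1).+1)
        q ^+ (n1 ^ 2 + n2 ^ 2 - n1 * n2 + n1 + n2)%N / qpoch q q n1
          * gauss_binom q (2 * n1)%N n2)
        (1 / qpochs_inf [:: q ^+ 2; q ^+ 3; q ^+ 3; q ^+ 4; q ^+ 4; q ^+ 5]
               (q ^+ 7)),
      fps_has_sum (fun n1 => \sum_(0 <= n2 < (2 * n1).+1)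
        q ^+ (n1 ^ 2 + n2 ^ 2 - n1 * n2 + n2)%N / qpoch q q n1
          * gauss_binom q (2 * n1)%N n2)
        (1 / qpochs_inf [:: q; q ^+ 2; q ^+ 3; q ^+ 4; q ^+ 5; q ^+ 6]
               (q ^+ 7)),
      fps_has_sum (fun n1 => \sum_(0 <= n2 < (2 * n1 + 1).+1)
        q ^+ (n1 ^ 2 + n2 ^ 2 - n1 * n2 + n1)%N / qpoch q q n1
          * gauss_binom q (2 * n1 + 1)%N n2)
        (1 / qpochs_inf [:: q; q ^+ 2; q ^+ 3; q ^+ 4; q ^+ 5; q ^+ 6]
               (q ^+ 7)),
      fps_has_sum (fun n1 => \sum_(0 <= n2 < (2 * n1 + 1).+1)
        q ^+ (n1 ^ 2 + n2 ^ 2 - n1 * n2 + n2)%N / qpoch q q n1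
          * gauss_binom q (2 * n1 + 1)%N n2)
        (1 / qpochs_inf [:: q; q ^+ 2; q ^+ 2; q ^+ 5; q ^+ 5; q ^+ 6]
               (q ^+ 7))
    & fps_has_sum (fun n1 => \sum_(0 <= n2 < (2 * n1).+1)
        q ^+ (n1 ^ 2 + n2 ^ 2 - n1 * n2)%N / qpoch q q n1
          * gauss_binom q (2 * n1)%N n2)
        (1 / qpochs_inf [:: q; q; q ^+ 3; q ^+ 4; q ^+ 6; q ^+ 6]
               (q ^+ 7))].
Proof.
move=> q.
have U : qpoch_inf q q \is a GRing.unit by apply: qpoch_inf_unit.
have U7 : qpoch7 7 \is a GRing.unit by apply: qpoch_inf_unit; apply: fcoef0X.
have D := qpoch_inf_dissect7.
split; rewrite qpochs_inf6.
- apply: (@dval_has_sum 0 1 1) => [|n]; last first.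
    by rewrite /dsum_coef addn0; apply: eq_bigr => s _; rewrite /qexp !mul1n.
  (* The pair (2, 1) belongs to the profile 400; the range and alcove conditions hold by
     computation. *)
  have h := @cyl_product cylG400 2 1 _ erefl erefl erefl erefl _ (hsum_dval 0 1 1).
  by apply: (product400 D U U7 (h _)) => n; have [] := cylH_lat n.
- apply: (@dval_has_sum 0 0 1) => [|n]; last first.
    by rewrite /dsum_coef addn0; apply: eq_bigr => s _; rewrite /qexp mul1n addn0.
  have h := @cyl_product cylG310 3 1 _ erefl erefl erefl erefl _ (hsum_dval 0 0 1).
  by apply: (product310 D U U7 (h _)) => n; have [] := cylH_lat n.
- apply: (@dval_has_sum 1 1 0) => [|n]; last first.
    by rewrite /dsum_coef; apply: eq_bigr => s _; rewrite /qexp mul1n addn0.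
  have h := @cyl_product cylG301 3 2 _ erefl erefl erefl erefl _ hsum_cylG301.
  by apply: (product301 D U U7 (h _)) => n; have [] := cylH_lat n.
- apply: (@dval_has_sum 1 0 1) => [|n]; last first.
    by rewrite /dsum_coef; apply: eq_bigr => s _; rewrite /qexp mul1n addn0.
  have h := @cyl_product cylG220 4 1 _ erefl erefl erefl erefl _ hsum_cylG220.
  by apply: (product220 D U U7 (h _)) => n; have [] := cylH_lat n.
- apply: (@dval_has_sum 0 0 0) => [|n]; last first.
    by rewrite /dsum_coef addn0; apply: eq_bigr => s _; rewrite /qexp !addn0.
  have h := @cyl_product cylG211 4 2 _ erefl erefl erefl erefl _ (hsum_dval 0 0 0).
  by apply: (product211 D U U7 (h _)) => n; have [] := cylH_lat n.
Qed.
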